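(* Let $0\le\mathfrak a<\mathfrak b$, $\mathfrak c\ge0$, $\kappa=(0,\kappa_2,\kappa_3)$ with $\kappa_2>-\frac12$, $\kappa_3>-1$. Define, for $v\neq0$, $$\mathfrak D=(1-u^2)\partial_{uu}-2(v^2-\mathfrak c)\frac uv\partial_{uv}+\Big[\mathfrak a+\mathfrak b-v^2+\frac{-\mathfrak a\mathfrak b+(\mathfrak a-\mathfrak c)(\mathfrak b-\mathfrak c)u^2}{v^2}\Big]\partial_{vv}+\Big[\mathfrak c-2\mathfrak a-\frac{-\mathfrak a\mathfrak b+(\mathfrak a-\mathfrak c)(\mathfrak b-\mathfrak c)u^2}{v^2}\Big]\frac1v\partial_v-(2\kappa_2+2\kappa_3+3)\Big[u\partial_u+\frac{v^2-\mathfrak a}{v}\partial_v\Big]+2\kappa_2(\mathfrak b-\mathfrak a)\frac1v\partial_v.$$ Then every $Y\in\mathcal V^{\circ,\mathsf E}_n(\mathsf W^\kappa_{\mathfrak a,\mathfrak b,\mathfrak c},\Omega_{\mathfrak a,\mathfrak b,\mathfrak c})$ satisfies $\mathfrak D Y=-n(n+2\kappa_2+2\kappa_3+2)Y$ on $\Omega_{\mathfrak a,\mathfrak b,\mathfrak c}$ (at points with $v\ne0$). Moreover, for every twice continuously differentiable $f$ on the interior of the upper half disk, $\mathfrak D(f\circ\psi)=(\mathcal D f)\circ\psi$ on the interior of $\Lambda_{\mathfrak a,\mathfrak b,\mathfrak c}$, where $$\mathcal D=(1-s^2)\partial_{ss}-2st\partial_{st}+(1-t^2)\partial_{tt}-(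2\kappa_2+2\kappa_3+3)(s\partial_s+t\partial_t)+\frac{2\kappa_2}{t}\partial_t.$$
   Context: $\Omega_{\mathfrak a,\mathfrak b,\mathfrak c}=\{(u,v):|u|\le1,\ \mathfrak a+(\mathfrak c-\mathfrak a)u^2\le v^2\le\mathfrak b+(\mathfrak c-\mathfrak b)u^2\}$, $\Lambda_{\mathfrak a,\mathfrak b,\mathfrak c}=\{(u,v)\in\Omega_{\mathfrak a,\mathfrak b,\mathfrak c}:v\ge0\}$, weight $\mathsf W^\kappa_{\mathfrak a,\mathfrak b,\mathfrak c}(u,v)=|v|\Big(\frac{-\mathfrak a+(\mathfrak a-\mathfrak c)u^2+v^2}{\mathfrak b-\mathfrak a}\Big)^{\kappa_2-\frac12}\Big(\frac{\mathfrak b-(\mathfrak b-\mathfrak c)u^2-v^2}{\mathfrak b-\mathfrak a}\Big)^{\kappa_3}$ (the case $\kappa_1=0$). $\mathcal V^{\circ,\mathsf E}_n(\mathsf W,\Omega)$ is the space of polynomials of degree $n$, even in the second variable, orthogonal in $L^2(\mathsf W,\Omega)$ to all polynomials of lower degree. $\psi(u,v)=(u,\mathfrak t(u,v))$ with $\mathfrak t(u,v)=\sqrt{\frac{-\mathfrak a+(\mathfrak a-\mathfrak c)u^2+v^2}{\mathfrak b-\mathfrak a}}$, mapping $\Lambda_{\mathfrak a,\mathfrak b,\mathfrak c}$ onto $\{(s,t):s^2+t^2\le1,t\ge0\}$. *)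

(* Defs.v *)
From HB Require Import structures.
From mathcomp Require Import all_boot all_order all_algebra.
From mathcomp Require Import all_classical all_reals all_analysis.
Set Implicit Arguments. Unset Strict Implicit. Unset Printing Implicit Defensive.
Import Order.TTheory GRing.Theory Num.Theory.
Import numFieldNormedType.Exports.
Local Open Scope classical_set_scope.
Local Open Scope ring_scope.

Section Defs.
Variable R : realType.
Variables (a b c k2 k3 : R).

Definition Omega : set (R * R) :=
  [set p | `|p.1| <= 1 /\
     a + (c - a) * p.1 ^+ 2 <= p.2 ^+ 2 /\ p.2 ^+ 2 <= b + (c - b) * p.1 ^+ 2].

Definition Lambda : set (R * R) := [set p | Omega p /\ 0 <= p.2].

Definition upper_half_disk : set (R * R) :=
  [set p | p.1 ^+ 2 + p.2 ^+ 2 <= 1 /\ 0 <= p.2].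

Definition weight (p : R * R) : R :=
  `|p.2| * powR ((- a + (a - c) * p.1 ^+ 2 + p.2 ^+ 2) / (b - a)) (k2 - 2^-1)
         * powR ((b - (b - c) * p.1 ^+ 2 - p.2 ^+ 2) / (b - a)) k3.

Definition tt (p : R * R) : R :=
  Num.sqrt ((- a + (a - c) * p.1 ^+ 2 + p.2 ^+ 2) / (b - a)).
Definition psi (p : R * R) : R * R := (p.1, tt p).

End Defs.

Definition poly2_le (R : realType) (n : nat) (Y : R * R -> R) : Prop :=
  exists coef : nat -> nat -> R, forall p : R * R,
    Y p = \sum_(i < n.+1) \sum_(j < n.+1 - i) coef i j * p.1 ^+ i * p.2 ^+ j.

Definition L2ip (R : realType) (W : R * R -> R) (D : set (R * R))
    (f g : R * R -> R) : \bar R :=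
  (\int[((@lebesgue_measure R) \x (@lebesgue_measure R))%E]_(p in D)
      (f p * g p * W p)%:E)%E.

Definition VnE (R : realType) (W : R * R -> R) (D : set (R * R)) (n : nat)
    (Y : R * R -> R) : Prop :=
  [/\ poly2_le n Y,
      (forall p : R * R, Y (p.1, - p.2) = Y p) &
      (forall m : nat, (m < n)%N -> forall P, poly2_le m P ->
          L2ip W D Y P = 0%E)].

Definition pd1 (R : realType) (f : R * R -> R) (p : R * R) : R :=
  derive1 (fun x => f (x, p.2)) p.1.
Definition pd2 (R : realType) (f : R * R -> R) (p : R * R) : R :=
  derive1 (fun y => f (p.1, y)) p.2.

Definition C2_on (R : realType) (U : set (R * R)) (f : R * R -> R) : Prop :=
  forall p, U p ->
    [/\ forall g, g \in [:: f; pd1 f; pd2 f] ->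
          derivable (fun x => g (x, p.2)) p.1 1 /\
          derivable (fun y => g (p.1, y)) p.2 1
      & forall g, g \in [:: f; pd1 f; pd2 f; pd1 (pd1 f); pd1 (pd2 f);
                            pd2 (pd1 f); pd2 (pd2 f)] ->
          {for p, continuous g}].

(* the operator \mathfrak D (for v <> 0); f_uv = pd1 (pd2 f) *)
Definition frakD (R : realType) (a b c k2 k3 : R) (f : R * R -> R)
    (p : R * R) : R :=
  let u := p.1 in let v := p.2 in
  let Q := - (a * b) + (a - c) * (b - c) * u ^+ 2 in
  (1 - u ^+ 2) * pd1 (pd1 f) p
  - 2 * (v ^+ 2 - c) * (u / v) * pd1 (pd2 f) p
  + (a + b - v ^+ 2 + Q / v ^+ 2) * pd2 (pd2 f) p
  + (c - 2 * a - Q / v ^+ 2) * v^-1 * pd2 f p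
  - (2 * k2 + 2 * k3 + 3) * (u * pd1 f p + (v ^+ 2 - a) / v * pd2 f p)
  + 2 * k2 * (b - a) * v^-1 * pd2 f p.

Definition calD (R : realType) (k2 k3 : R) (f : R * R -> R) (p : R * R) : R :=
  let s := p.1 in let t := p.2 in
  (1 - s ^+ 2) * pd1 (pd1 f) p - 2 * s * t * pd1 (pd2 f) p
  + (1 - t ^+ 2) * pd2 (pd2 f) p
  - (2 * k2 + 2 * k3 + 3) * (s * pd1 f p + t * pd2 f p)
  + 2 * k2 / t * pd2 f p.

(* Main.v *)
(** Write tau = t^2.  An even polynomial in (u, v) of degree at most n is a
    combination of the functions u^i tau^j with i + 2j <= n, and on these the
    operator acts by
      u^i tau^j |-> i(i-1) u^(i-2) tau^j - m(m+2k2+2k3+2) u^i tau^j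
                    + 2j(2j-1+2k2) u^i tau^(j-1),   m = i + 2j.
    The substitution v -> tau turns the moments of u^i tau^j into products of a Beta
    and a Gegenbauer integral; their two first-order recurrences are exactly what
    makes the operator self-adjoint for the weight.  Hence for Y in the
    orthogonal space of degree n, the residual of the eigenvalue equation is an even
    polynomial of degree < n orthogonal to itself, so it vanishes on Omega.
    The second claim is the chain rule, with the symmetry of the mixed second
    derivatives. *)
Require Import Defs.
From HB Require Import structures.
From mathcomp Require Import all_boot all_order all_algebra.
From mathcomp Require Import ring lra zify.
From mathcomp Require Import all_classical all_reals all_analysis.
From mathcomp Require Import measurable_realfun.
Set Implicit Arguments. Unset Strict Implicit. Unset Printing Implicit Defensive.
Import Order.TTheory GRing.Theory Num.Theory.
Import numFieldNormedType.Exports.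
Local Open Scope classical_set_scope.
Local Open Scope ring_scope.

(** * Integration on open intervals *)

(** The exponents k2 - 1/2 and k3 may be negative, so the weight can be unbounded near the boundary
    of [Omega] and its integrability cannot be read off compactness. It is obtained, along with the
    recurrences, from a fundamental theorem of calculus on open intervals that tolerates infinite
    integrals. The operator is never integrated by parts in the plane, where its coefficients have
    poles at v = 0 and the weight is singular. Testing it on pairs of monomials leaves an algebraic
    identity between moments, and this identity holds because both moment recurrences carry the same
    coefficient, whose product with the difference of two degrees m and m' is the difference of
    their eigenvalues: (m - m')(m + m' + 2 k2 + 2 k3 + 2). A zero integral of the squared residual
    only gives vanishing where the weight is positive; boundary points of [Omega] need a continuity
    argument, made in the coordinates (u, tau), where the region is u^2 + tau <= 1 with tau >= 0.
    For the second claim, [C2_on] provides separate partial derivatives and their continuity, so the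
    chain rule and the symmetry of mixed derivatives are derived from the one-variable mean value
    theorem. *)

Lemma itv_bigcup_cc (R : realType) (a b : R) (x y : nat -> R) :
  (forall n, a < x n) -> (forall n, y n < b) ->
  x n @[n --> \oo] --> a -> y n @[n --> \oo] --> b ->
  \bigcup_n `[x n, y n]%classic = `]a, b[%classic.
Proof.
move=> ax yb xa yb'; apply/seteqP; split=> [t [n _]|t] /=; rewrite !in_itv/=.
  by move=> /andP[xt ty]; rewrite (lt_le_trans (ax n) xt) (le_lt_trans ty (yb n)).
move=> /andP[at_ tb].
have : \forall n \near \oo, x n <= t by near do apply/ltW; exact: (cvgr_lt a).
have : \forall n \near \oo, t <= y n by near do apply/ltW; exact: (cvgr_gt b).
move=> H1 H2; near \oo => n; exists n => //=; rewrite in_itv/=.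
by apply/andP; split; near: n.
Unshelve. all: end_near. Qed.

(** Monotone convergence along an increasing sequence of sets. The limit may be infinite, which is
    what later allows finiteness to be a conclusion. *)
Lemma ge0_cvg_integral_oo (R : realType) (a b : R) (x y : nat -> R) (f : R -> \bar R) :
  (forall n, a < x n) -> (forall n, y n < b) ->
  {homo x : m n / (m <= n)%N >-> (n <= m)} ->
  {homo y : m n / (m <= n)%N >-> (m <= n)} ->
  x n @[n --> \oo] --> a -> y n @[n --> \oo] --> b ->
  measurable_fun `]a, b[%classic f -> (forall t, t \in `]a, b[ -> (0 <= f t)%E) ->
  (\int[lebesgue_measure]_(t in `[x n, y n]) f t)%E @[n --> \oo] -->
  (\int[lebesgue_measure]_(t in `]a, b[) f t)%E.
Proof.
move=> ax yb hx hy xa yb' mf f0.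
have sub n : `[x n, y n]%classic `<=` `]a, b[%classic.
  by rewrite -(itv_bigcup_cc ax yb xa yb') => t tn; exists n.
rewrite -(itv_bigcup_cc ax yb xa yb'); apply: ge0_nondecreasing_set_cvg_integral => //.
- move=> m n mn; apply/subsetPset => t /=; rewrite !in_itv/= => /andP[h1 h2].
  by rewrite (le_trans (hx _ _ mn)) //= (le_trans h2) // hy.
- by move=> n; apply: measurable_funS mf.
- by move=> n t /sub /f0.
Qed.

(** The factor 1/3 keeps [lseq] strictly to the left of [rseq] already at [n = 0], so that every
    compact interval between them is nondegenerate. *)
Definition lseq (R : realType) (a b : R) (n : nat) : R := a + (b - a) / 3 * n.+1%:R^-1.
Definition rseq (R : realType) (a b : R) (n : nat) : R := b - (b - a) / 3 * n.+1%:R^-1.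

Section exhausting_sequences.
Context (R : realType) (a b : R) (ab : a < b).

Lemma step_gt0_le n : 0 < (b - a) / 3 * n.+1%:R^-1 <= (b - a) / 3.
Proof.
have d0 : 0 < (b - a) / 3 by rewrite divr_gt0 ?subr_gt0.
apply/andP; split; first by rewrite mulr_gt0// invr_gt0 ltr0n.
by rewrite ler_piMr ?(ltW d0)// invf_le1 ?ltr0n// ler1n.
Qed.

Lemma lseq_gt n : a < lseq a b n.
Proof. by rewrite ltrDl; have /andP[] := step_gt0_le n. Qed.

Lemma rseq_lt n : rseq a b n < b.
Proof. by rewrite ltrBlDr ltrDl; have /andP[] := step_gt0_le n. Qed.

Lemma lseq_lt_rseq n : lseq a b n < rseq a b n.
Proof.
by rewrite /rseq /lseq; move: (step_gt0_le n) ab; move: (_ * n.+1%:R^-1) => d /andP[h1 h2] ?; lra.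
Qed.

Lemma lseq_homo : {homo lseq a b : m n / (m <= n)%N >-> (n <= m)}.
Proof.
move=> m n mn; rewrite /lseq lerD2l ler_wpM2l ?divr_ge0 ?subr_ge0 ?(ltW ab)//.
by rewrite lef_pV2 ?posrE ?ltr0n// ler_nat.
Qed.

Lemma rseq_homo : {homo rseq a b : m n / (m <= n)%N >-> (m <= n)}.
Proof.
move=> m n mn; rewrite /rseq lerD2l lerN2 ler_wpM2l ?divr_ge0 ?subr_ge0 ?(ltW ab)//.
by rewrite lef_pV2 ?posrE ?ltr0n// ler_nat.
Qed.

Lemma lseq_cvg : lseq a b n @[n --> \oo] --> a.
Proof.
rewrite -[X in _ --> X]addr0; apply: cvgD; first exact: cvg_cst.
by rewrite -[X in _ --> X](mulr0 ((b - a) / 3)); apply: cvgM; [exact: cvg_cst|exact: cvg_harmonic].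
Qed.

Lemma rseq_cvg : rseq a b n @[n --> \oo] --> b.
Proof.
rewrite -[X in _ --> X]subr0; apply: cvgB; first exact: cvg_cst.
by rewrite -[X in _ --> X](mulr0 ((b - a) / 3)); apply: cvgM; [exact: cvg_cst|exact: cvg_harmonic].
Qed.

Lemma cvg_lseq (V : topologicalType) (F : R -> V) (l : V) :
  F x @[x --> a^'+] --> l -> F (lseq a b n) @[n --> \oo] --> l.
Proof.
move=> Fl; apply: (cvg_comp (lseq a b)) Fl => /=.
move=> A [e /= e0 H]; have /cvgrPdist_lt /(_ _ e0) := lseq_cvg.
apply: filterS => n h; apply: H => //=; exact: lseq_gt.
Qed.

Lemma cvg_rseq (V : topologicalType) (F : R -> V) (l : V) :
  F x @[x --> b^'-] --> l -> F (rseq a b n) @[n --> \oo] --> l.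
Proof.
move=> Fl; apply: (cvg_comp (rseq a b)) Fl => /=.
move=> A [e /= e0 H]; have /cvgrPdist_lt /(_ _ e0) := rseq_cvg.
apply: filterS => n h; apply: H => //=; exact: rseq_lt.
Qed.

End exhausting_sequences.

Lemma measurable_oo_continuous (R : realType) (a b : R) (f : R -> R) :
  (forall x, x \in `]a, b[ -> {for x, continuous f}) ->
  measurable_fun `]a, b[%classic (EFin \o f).
Proof.
move=> cf; apply/measurable_EFinP; apply: open_continuous_measurable_fun => //.
by move=> x; rewrite inE => /cf.
Qed.

Lemma within_cc_of_oo (R : realType) (a b x y : R) (f : R -> R) : a < x -> y < b ->
  (forall x, x \in `]a, b[ -> {for x, continuous f}) ->
  {within `[x, y]%classic, continuous f}.
Proof.
move=> ax yb cf; apply: continuous_in_subspaceT => t; rewrite inE/= in_itv/= => /andP[h1 h2].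
by apply: cf; rewrite in_itv/= (lt_le_trans ax h1) (le_lt_trans h2 yb).
Qed.

Lemma is_derive_continuous (R : realType) (f : R -> R) (x df : R) :
  is_derive x 1 f df -> {for x, continuous f}.
Proof. by move=> h; apply/differentiable_continuous/derivable1_diffP; exact: ex_derive. Qed.

(* Splitting the derivative as g - h with g, h >= 0 makes the formula valid without
   assuming integrability, which is then derived from it. *)
Lemma ge0_FTC_oo (R : realType) (a b l r : R) (g h F : R -> R) : a < b ->
  (forall x, x \in `]a, b[ -> 0 <= g x) -> (forall x, x \in `]a, b[ -> 0 <= h x) ->
  (forall x, x \in `]a, b[ -> {for x, continuous g}) ->
  (forall x, x \in `]a, b[ -> {for x, continuous h}) ->
  (forall x, x \in `]a, b[ -> is_derive x 1 F (g x - h x)) ->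
  F x @[x --> a^'+] --> l -> F x @[x --> b^'-] --> r ->
  (\int[lebesgue_measure]_(x in `]a, b[) (g x)%:E + l%:E =
   \int[lebesgue_measure]_(x in `]a, b[) (h x)%:E + r%:E)%E.
Proof.
move=> ab g0 h0 cg ch dF Fl Fr.
pose x := lseq a b; pose y := rseq a b.
(* On a compact subinterval both integrals are finite, so the usual formula can be rearranged into
   one without subtraction; in that form it passes to the limit in the extended reals. *)
have H n : (\int[lebesgue_measure]_(t in `[x n, y n]) (g t)%:E + (F (x n))%:E =
   \int[lebesgue_measure]_(t in `[x n, y n]) (h t)%:E + (F (y n))%:E)%E.
  have axn := lseq_gt ab n; have ybn := rseq_lt ab n; have xyn := lseq_lt_rseq ab n.
  have ooS t : t \in `](x n), (y n)[ -> t \in `]a, b[.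
    rewrite !in_itv/= => /andP[h1 h2]; by rewrite (lt_trans axn h1) (lt_trans h2 ybn).
  have ig : lebesgue_measure.-integrable `[x n, y n] (EFin \o g).
    by apply: continuous_compact_integrable; [exact: segment_compact|exact: (within_cc_of_oo axn ybn)].
  have ih : lebesgue_measure.-integrable `[x n, y n] (EFin \o h).
    by apply: continuous_compact_integrable; [exact: segment_compact|exact: (within_cc_of_oo axn ybn)].
  have cF t : t \in `]a, b[ -> {for t, continuous F}.
    by move=> /dF /is_derive_continuous.
  have fB : (\int[lebesgue_measure]_(t in `[x n, y n]) ((g t)%:E - (h t)%:E) = (F (y n))%:E - (F (x n))%:E)%E.
    apply: (@continuous_FTC2 R (fun t => g t - h t) F (x n) (y n) xyn).
    - by apply: (within_cc_of_oo axn ybn) => t tab; apply: cvgB; [exact: cg|exact: ch].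
    - split.
      + by move=> t /ooS /dF dt; exact: ex_derive.
      + by apply: cvg_at_right_filter; apply: cF; rewrite in_itv/= axn (lt_trans xyn ybn).
      + by apply: cvg_at_left_filter; apply: cF; rewrite in_itv/= ybn (lt_trans axn xyn).
    - by move=> t /ooS /dF dt; rewrite derive1E derive_val.
  have fB' : (\int[lebesgue_measure]_(t in `[x n, y n]) (g t)%:E - \int[lebesgue_measure]_(t in `[x n, y n]) (h t)%:E = (F (y n))%:E - (F (x n))%:E)%E.
    by rewrite -fB; apply/esym; apply: integralB_EFin.
  have fg : (\int[lebesgue_measure]_(t in `[x n, y n]) (g t)%:E)%E \is a fin_num by apply: integrable_fin_num.
  have fh : (\int[lebesgue_measure]_(t in `[x n, y n]) (h t)%:E)%E \is a fin_num by apply: integrable_fin_num.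
  move: fB' fg fh.
  case: (\int[_]_(_ in _) (h _)%:E)%E => [H| |]//; case: (\int[_]_(_ in _) (g _)%:E)%E => [G| |]//.
  by rewrite -!EFinB -!EFinD => -[?] _ _; congr EFin; lra.
have Hg : (\int[lebesgue_measure]_(t in `[x n, y n]) (g t)%:E + (F (x n))%:E)%E @[n --> \oo] -->
   (\int[lebesgue_measure]_(x in `]a, b[) (g x)%:E + l%:E)%E.
  apply: cvgeD; first by rewrite /adde_def/= !andbF.
  + apply: ge0_cvg_integral_oo => //; [exact: lseq_gt|exact: rseq_lt|exact: lseq_homo|exact: rseq_homo|exact: lseq_cvg|exact: rseq_cvg|exact: measurable_oo_continuous].
  + by apply: cvg_EFin; [exact: nearW|exact: cvg_lseq].
have Hh : (\int[lebesgue_measure]_(t in `[x n, y n]) (h t)%:E + (F (y n))%:E)%E @[n --> \oo] -->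
   (\int[lebesgue_measure]_(x in `]a, b[) (h x)%:E + r%:E)%E.
  apply: cvgeD; first by rewrite /adde_def/= !andbF.
  + apply: ge0_cvg_integral_oo => //; [exact: lseq_gt|exact: rseq_lt|exact: lseq_homo|exact: rseq_homo|exact: lseq_cvg|exact: rseq_cvg|exact: measurable_oo_continuous].
  + by apply: cvg_EFin; [exact: nearW|exact: cvg_rseq].
have E : (fun n => \int[lebesgue_measure]_(t in `[x n, y n]) (g t)%:E + (F (x n))%:E)%E =
  (fun n => \int[lebesgue_measure]_(t in `[x n, y n]) (h t)%:E + (F (y n))%:E)%E by apply/funext.
rewrite E in Hg; exact: (cvg_unique _ Hg Hh).
Qed.
(** Substitution on compact subintervals, followed by monotone convergence on both sides. The
    endpoints enter only as limits of [F], so the derivative of [F] and the integrand may blow up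
    there. *)
Lemma ge0_substitution_oo (R : realType) (a b l r : R) (F f G : R -> R) : a < b ->
  (forall x, x \in `]a, b[ -> is_derive x 1 F (f x)) ->
  (forall x, x \in `]a, b[ -> {for x, continuous f}) ->
  (forall x, x \in `]a, b[ -> 0 <= f x) ->
  {in `]a, b[ &, {homo F : x y / x < y}} ->
  F x @[x --> a^'+] --> l -> F x @[x --> b^'-] --> r ->
  (forall x, x \in `]l, r[ -> 0 <= G x) ->
  (forall x, x \in `]l, r[ -> {for x, continuous G}) ->
  (\int[lebesgue_measure]_(x in `]l, r[) (G x)%:E =
   \int[lebesgue_measure]_(x in `]a, b[) (G (F x) * f x)%:E)%E.
Proof.
move=> ab dF cf f0 hF Fl Fr G0 cG.
pose x := lseq a b; pose y := rseq a b.
have xab n : x n \in `]a, b[.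
  by rewrite in_itv/= lseq_gt//= (lt_trans (lseq_lt_rseq ab n))// rseq_lt.
have yab n : y n \in `]a, b[.
  by rewrite in_itv/= rseq_lt// (lt_trans _ (lseq_lt_rseq ab n))// lseq_gt.
(* The limit only yields a weak inequality; comparing with the midpoint of a and t and using strict
   monotonicity makes it strict. *)
have lF t : t \in `]a, b[ -> l < F t.
  move=> tab; have /[!in_itv]/= /andP[at_ tb] := tab.
  have mab : (a + t) / 2 \in `]a, b[ by rewrite in_itv/=; apply/andP; split; lra.
  apply: (@le_lt_trans _ _ (F ((a + t) / 2))); last by apply: hF => //; lra.
  rewrite -(cvg_lim _ (cvg_lseq ab Fl))//; apply: limr_le; first exact: cvgP (cvg_lseq ab Fl).
  near=> n; apply/ltW/hF => //; near: n; apply: (cvgr_lt a); [exact: lseq_cvg|lra].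
have Fr' t : t \in `]a, b[ -> F t < r.
  move=> tab; have /[!in_itv]/= /andP[at_ tb] := tab.
  have mab : (t + b) / 2 \in `]a, b[ by rewrite in_itv/=; apply/andP; split; lra.
  apply: (@lt_le_trans _ _ (F ((t + b) / 2))); first by apply: hF => //; lra.
  rewrite -(cvg_lim _ (cvg_rseq ab Fr))//; apply: limr_ge; first exact: cvgP (cvg_rseq ab Fr).
  near=> n; apply/ltW/hF => //; near: n; apply: (cvgr_gt b); [exact: rseq_cvg|lra].
have FG t : t \in `]a, b[ -> F t \in `]l, r[ by move=> tab; rewrite in_itv/= lF// Fr'.
have Fle s t : s \in `]a, b[ -> t \in `]a, b[ -> s <= t -> F s <= F t.
  by move=> sab tab; rewrite le_eqVlt => /predU1P[->//|st]; apply/ltW/hF.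
have cF t : t \in `]a, b[ -> {for t, continuous F}.
  by move=> /dF /is_derive_continuous.
(* The derivative function agrees with [f] only inside the interval, hence near [t], which is enough
   to transfer continuity. *)
have cF' t : t \in `]a, b[ -> {for t, continuous F^`()%classic}.
  move=> tab; have E : {near t, f =1 F^`()%classic}.
    near=> s; rewrite derive1E; have := dF s; have -> : s \in `]a, b[ by near: s; exact: near_in_itvoo.
    by move=> /(_ isT) ds; rewrite derive_val.
  rewrite /prop_for /continuous_at -(nbhs_singleton E); apply: cvg_trans (cf _ tab); exact: near_eq_cvg.
have H n : (\int[lebesgue_measure]_(t in `[F (x n), F (y n)]) (G t)%:E =
   \int[lebesgue_measure]_(t in `[x n, y n]) (G (F t) * f t)%:E)%E.
  have axn := lseq_gt ab n; have ybn := rseq_lt ab n; have xyn := lseq_lt_rseq ab n.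
  have ccS t : t \in `[x n, y n] -> t \in `]a, b[.
    rewrite !in_itv/= => /andP[h1 h2]; by rewrite (lt_le_trans axn h1) (le_lt_trans h2 ybn).
  have ooS t : t \in `](x n), (y n)[ -> t \in `]a, b[.
    move=> h; apply: ccS; exact: subset_itv_oo_cc h.
  rewrite (@integration_by_substitution_increasing R F G (x n) (y n) (ltW xyn)).
  - apply: eq_integral => t; rewrite inE/= => /ccS tab; have dt := dF t tab.
    have -> : ((G \o F) * F^`()%classic) t = G (F t) * F^`()%classic t by [].
    by rewrite derive1E derive_val.
  - by move=> s t /ccS sab /ccS tab; exact: hF.
  - by move=> t /ooS; exact: cF'.
  - apply/cvg_ex; eexists; apply: cvg_at_right_filter; exact: cF'.
  - apply/cvg_ex; eexists; apply: cvg_at_left_filter; exact: cF'.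
  - split.
    + by move=> t /ooS tab; have dt := dF _ tab; exact: ex_derive.
    + by apply: cvg_at_right_filter; exact: cF.
    + by apply: cvg_at_left_filter; exact: cF.
  - exact: (within_cc_of_oo (lF _ (xab n)) (Fr' _ (yab n)) cG).
have HG : (\int[lebesgue_measure]_(t in `[F (x n), F (y n)]) (G t)%:E)%E @[n --> \oo] -->
   (\int[lebesgue_measure]_(x in `]l, r[) (G x)%:E)%E.
  apply: (@ge0_cvg_integral_oo R l r (F \o x) (F \o y)) => /=.
  - by move=> n; exact: lF.
  - by move=> n; exact: Fr'.
  - by move=> m n mn; apply: Fle => //; exact: lseq_homo.
  - by move=> m n mn; apply: Fle => //; exact: rseq_homo.
  - exact: cvg_lseq.
  - exact: cvg_rseq.
  - exact: measurable_oo_continuous.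
  - by move=> t /G0; rewrite lee_fin.
have HF : (\int[lebesgue_measure]_(t in `[x n, y n]) (G (F t) * f t)%:E)%E @[n --> \oo] -->
   (\int[lebesgue_measure]_(x in `]a, b[) (G (F x) * f x)%:E)%E.
  apply: ge0_cvg_integral_oo => /=.
  - by move=> n; exact: lseq_gt.
  - by move=> n; exact: rseq_lt.
  - exact: lseq_homo.
  - exact: rseq_homo.
  - exact: lseq_cvg.
  - exact: rseq_cvg.
  - apply: measurable_oo_continuous => t tab; apply: cvgM; last exact: cf.
    by apply: continuous_comp; [exact: cF|apply: cG; exact: FG].
  - by move=> t tab; rewrite lee_fin mulr_ge0 ?f0 ?G0// FG.
rewrite (funext H) in HG; exact: (cvg_unique _ HG HF).
Unshelve. all: end_near. Qed.

(** * Derivatives of powers, and integrability criteria on open intervals *)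

Lemma is_derive_exprn (R : realType) (f : R -> R) (x df : R) (n : nat) :
  is_derive x 1 f df -> is_derive x 1 (fun y => f y ^+ n) (n%:R * f x ^+ n.-1 * df).
Proof.
move=> hf; have -> : (fun y => f y ^+ n) = f ^+ n by rewrite exprfctE.
by apply: is_derive_eq.
Qed.

Lemma is_derive_powR (R : realType) (f : R -> R) (x df a : R) : 0 < f x ->
  is_derive x 1 f df -> is_derive x 1 (fun y => f y `^ a) (a * f x `^ (a - 1) * df).
Proof.
move=> fx0 hf; have h := is_derive1_powR a fx0.
exact: (is_derive1_comp h hf).
Qed.

Lemma is_derive_sqrt (R : realType) (f : R -> R) (x df : R) : 0 < f x ->
  is_derive x 1 f df -> is_derive x 1 (fun y => Num.sqrt (f y)) (df / (2 * Num.sqrt (f x))).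
Proof.
by move=> fx0 hf; have h := is_derive1_sqrt fx0; rewrite mulrC; exact: (is_derive1_comp h hf).
Qed.

Lemma cvg_powR0 (R : realType) (T : Type) (F : set_system T) (FF : Filter F) (f : T -> R) (p : R) :
  0 < p -> f x @[x --> F] --> 0 -> (\forall x \near F, 0 < f x) ->
  f x `^ p @[x --> F] --> 0.
Proof.
move=> p0 f0 fpos; apply: (cvg_comp f) (powR_cvg0 p0) => A [e /= e0 H].
have /cvgrPdist_lt /(_ _ e0) := f0.
by apply: filterS2 fpos => t ft h; apply: H.
Qed.

(** The positive and negative parts of [f] fit [ge0_FTC_oo]; integrability makes both integrals
    finite, so the resulting identity can be subtracted. *)
Lemma FTC_oo (R : realType) (a b l r : R) (f F : R -> R) : a < b ->
  lebesgue_measure.-integrable `]a, b[ (EFin \o f) ->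
  (forall x, x \in `]a, b[ -> {for x, continuous f}) ->
  (forall x, x \in `]a, b[ -> is_derive x 1 F (f x)) ->
  F x @[x --> a^'+] --> l -> F x @[x --> b^'-] --> r ->
  (\int[lebesgue_measure]_(x in `]a, b[) f x = r - l)%R.
Proof.
move=> ab fi cf dF Fl Fr.
pose g x := Num.max (f x) 0; pose h x := Num.max (- f x) 0.
have fE x : f x = g x - h x.
  rewrite /g /h; case: (leP (f x) 0); case: (leP (- f x) 0) => *; lra.
have cg x : x \in `]a, b[ -> {for x, continuous g}.
  by move=> /cf cx; apply: continuous_max => //; exact: cvg_cst.
have ch x : x \in `]a, b[ -> {for x, continuous h}.
  by move=> /cf cx; apply: continuous_max; [exact: cvgN|exact: cvg_cst].
have le_fi (k : R -> R) : (forall x, x \in `]a, b[ -> {for x, continuous k}) ->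
    (forall x, `|k x| <= `|f x|) -> lebesgue_measure.-integrable `]a, b[ (EFin \o k).
  move=> ck lek; apply: le_integrable fi => //; first exact: measurable_oo_continuous.
  by move=> x _; rewrite lee_fin.
have ig : lebesgue_measure.-integrable `]a, b[ (EFin \o g).
  apply: le_fi => // x; rewrite /g; case: (leP (f x) 0) => h0; first by rewrite normr0.
  by [].
have ih : lebesgue_measure.-integrable `]a, b[ (EFin \o h).
  apply: le_fi => // x; rewrite /h; case: (leP (- f x) 0) => h0; first by rewrite normr0.
  by rewrite normrN.
have := @ge0_FTC_oo R a b l r g h F ab.
move=> /(_ _ _ cg ch _ Fl Fr) H.
have {}H : (\int[lebesgue_measure]_(x in `]a, b[) (g x)%:E + l%:E =
   \int[lebesgue_measure]_(x in `]a, b[) (h x)%:E + r%:E)%E.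
  apply: H; [by move=> x _; rewrite le_max lexx orbT|by move=> x _; rewrite le_max lexx orbT|].
  by move=> x /dF; rewrite fE.
have fg : (\int[lebesgue_measure]_(t in `]a, b[) (g t)%:E)%E \is a fin_num by apply: integrable_fin_num.
have fh : (\int[lebesgue_measure]_(t in `]a, b[) (h t)%:E)%E \is a fin_num by apply: integrable_fin_num.
transitivity (\int[lebesgue_measure]_(x in `]a, b[) g x - \int[lebesgue_measure]_(x in `]a, b[) h x)%R.
  by rewrite -RintegralB//; apply: eq_Rintegral => x _; exact: fE.
rewrite /Rintegral; move: fg fh; move: H; case: (\int[_]_(_ in _) (h _)%:E)%E => [H| |]//.
case: (\int[_]_(_ in _) (g _)%:E)%E => [G| |]// + _ _ /=.
by rewrite -!EFinD => -[?]; lra.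
Qed.

Lemma integrable_oo_ge0 (R : realType) (a b : R) (f : R -> R) :
  (forall x, x \in `]a, b[ -> {for x, continuous f}) ->
  (forall x, x \in `]a, b[ -> 0 <= f x) ->
  (\int[lebesgue_measure]_(x in `]a, b[) (f x)%:E < +oo)%E ->
  lebesgue_measure.-integrable `]a, b[ (EFin \o f).
Proof.
move=> cf f0 foo; apply/integrableP; split; first exact: measurable_oo_continuous.
under eq_integral => x do [rewrite inE => /f0 h; rewrite /= ger0_norm//].
exact: foo.
Qed.

Lemma integrable_oo_bounded (R : realType) (a b M : R) (f : R -> R) :
  (forall x, x \in `]a, b[ -> {for x, continuous f}) ->
  (forall x, x \in `]a, b[ -> `|f x| <= M) ->
  lebesgue_measure.-integrable `]a, b[ (EFin \o f).
Proof.
move=> cf fM; apply: (@le_integrable _ _ _ _ _ _ _ (EFin \o cst M)) => //.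
- exact: measurable_oo_continuous.
- by move=> x /fM h; rewrite lee_fin (le_trans h) ?ler_norm.
- apply: measurable_bounded_integrable => //.
  + by rewrite /= lebesgue_measure_itv/=; case: ifP => _; rewrite ?ltry// -EFinB ltry.
  + exists `|M|; split; first exact: normr_real.
    by move=> t ht u _ /=; rewrite ltW.
Qed.
(** * Beta and Gegenbauer integrals *)

Lemma powR_le1 (R : realType) (x p : R) : 0 <= x <= 1 -> 0 <= p -> x `^ p <= 1.
Proof.
move=> /andP[x0 x1] p0; have <- : 1 `^ p = 1 :> R by rewrite powR1.
by rewrite ge0_ler_powR ?nnegrE.
Qed.

Lemma powR_mulVr (R : realType) (x p : R) : 0 < x -> x `^ p = x * x `^ (p - 1).
Proof.
move=> x0; rewrite -{2}(powRr1 (ltW x0)) -powRD; last by rewrite (gt_eqF x0) implybT.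
by congr (_ `^ _); ring.
Qed.

Section beta.
Context (R : realType).
Notation mu := (@lebesgue_measure R).

Definition betaf (p q x : R) : R := x `^ (p - 1) * (1 - x) `^ (q - 1).
Definition betaR (p q : R) : R := (\int[mu]_(x in `]0%R, 1%R[) betaf p q x)%R.

(** The derivative is displayed as a difference of two nonnegative terms when p and q are positive,
    the form required by [ge0_FTC_oo]. *)
Lemma is_derive_betaf (p q x : R) : x \in `]0, 1[ ->
  is_derive x 1 (betaf (p + 1) (q + 1)) (p * betaf p (q + 1) x - q * betaf (p + 1) q x).
Proof.
rewrite in_itv/= => /andP[x0 x1].
have h1 := is_derive_powR (p + 1 - 1) x0 (is_derive_id x 1).
have h2 : is_derive x 1 (fun y => 1 - y) (-1) by rewrite -sub0r; exact: is_deriveB.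
have x1' : 0 < 1 - x by rewrite subr_gt0.
have h3 := @is_derive_powR R (fun y => 1 - y) _ _ (q + 1 - 1) x1' h2.
apply: is_derive_eq (is_deriveM h1 h3) _.
by rewrite /betaf !addrK /GRing.scale/=; ring.
Qed.

Lemma continuous_betaf (p q x : R) : x \in `]0, 1[ -> {for x, continuous (betaf p q)}.
Proof.
move=> xI; apply: is_derive_continuous.
have := is_derive_betaf (p - 1) (q - 1) xI; rewrite !subrK; exact.
Qed.

Lemma betaf_ge0 (p q x : R) : 0 <= betaf p q x.
Proof. by rewrite mulr_ge0 ?powR_ge0. Qed.

Lemma cvg_betaf_right (p q : R) : 0 < p -> betaf (p + 1) q x @[x --> 0^'+] --> 0.
Proof.
move=> p0; rewrite -[X in _ --> X](mul0r ((1 - 0) `^ (q - 1))); apply: cvgM.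
  rewrite addrK; apply: cvg_powR0 => //; last exact: nbhs_right_gt.
  by apply: cvg_at_right_filter; exact: cvg_id.
apply: cvg_at_right_filter.
have h2 : is_derive (0 : R) 1 (fun y => 1 - y) (-1) by rewrite -sub0r; exact: is_deriveB.
have x1' : 0 < 1 - 0 :> R by rewrite subr0.
exact: (is_derive_continuous (@is_derive_powR R (fun y => 1 - y) _ _ (q - 1) x1' h2)).
Qed.

Lemma cvg_betaf_left (p q : R) : 0 < q -> betaf p (q + 1) x @[x --> 1^'-] --> 0.
Proof.
move=> q0; rewrite -[X in _ --> X](mulr0 (1 `^ (p - 1))); apply: cvgM.
  apply: cvg_at_left_filter.
  exact: (is_derive_continuous (is_derive_powR (p - 1) ltr01 (is_derive_id (1 : R) 1))).
rewrite addrK; apply: cvg_powR0 => //; last by near do rewrite subr_gt0; exact: nbhs_left_lt.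
apply: cvg_at_left_filter; rewrite -[X in _ --> X](subrr 1).
by apply: cvgB; [exact: cvg_cst|exact: cvg_id].
Unshelve. all: end_near. Qed.

Lemma betaf_split (p q x : R) : x \in `]0, 1[ ->
  betaf p q x = betaf (p + 1) q x + betaf p (q + 1) x.
Proof.
rewrite in_itv/= => /andP[x0 x1]; rewrite /betaf !addrK.
rewrite (powR_mulVr p x0) (@powR_mulVr _ (1 - x) q) ?subr_gt0//; ring.
Qed.

(** The boundary values of x^p (1 - x)^q vanish because p and q are positive. The identity is stated
    in the extended reals since finiteness of either side is deduced from it. *)
Lemma integral_betaf_by_parts (p q : R) : 0 < p -> 0 < q ->
  (p%:E * \int[mu]_(x in `]0%R, 1%R[) (betaf p (q + 1) x)%:E =
   q%:E * \int[mu]_(x in `]0%R, 1%R[) (betaf (p + 1) q x)%:E)%E.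
Proof.
move=> p0 q0.
have Z k p' q' : 0 < k -> (k%:E * \int[mu]_(x in `]0%R, 1%R[) (betaf p' q' x)%:E =
    \int[mu]_(x in `]0%R, 1%R[) (k * betaf p' q' x)%:E)%E.
  move=> k0; rewrite -ge0_integralZl//; last by rewrite lee_fin ltW.
  - by apply: measurable_oo_continuous => x; exact: continuous_betaf.
  - by move=> x _; rewrite lee_fin betaf_ge0.
rewrite (Z p p (q + 1) p0) (Z q (p + 1) q q0).
have := @ge0_FTC_oo R 0 1 0 0 (fun x => p * betaf p (q + 1) x) (fun x => q * betaf (p + 1) q x)
  (betaf (p + 1) (q + 1)) ltr01.
rewrite !adde0; apply.
- by move=> x _; rewrite mulr_ge0 ?betaf_ge0// ltW.
- by move=> x _; rewrite mulr_ge0 ?betaf_ge0// ltW.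
- by move=> x xI; apply: cvgM; [exact: cvg_cst|exact: continuous_betaf].
- by move=> x xI; apply: cvgM; [exact: cvg_cst|exact: continuous_betaf].
- by move=> x; exact: is_derive_betaf.
- exact: cvg_betaf_right.
- exact: cvg_betaf_left.
Qed.

(** For parameters (p + 1, q + 1) the integrand is bounded. Finiteness then descends: integration by
    parts gives (p, q + 2), the splitting 1 = x + (1 - x) gives (p, q + 1), integration by parts
    again gives (p + 1, q), and the splitting gives (p, q). *)
Lemma integrable_betaf (p q : R) : 0 < p -> 0 < q -> mu.-integrable `]0%R, 1%R[ (EFin \o betaf p q).
Proof.
move=> p0 q0.
have fin_ge0 p' q' : (0 <= \int[mu]_(x in `]0%R, 1%R[) (betaf p' q' x)%:E)%E.
  by apply: integral_ge0 => x _; rewrite lee_fin betaf_ge0.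
have splitE p' q' : (\int[mu]_(x in `]0%R, 1%R[) (betaf p' q' x)%:E =
   \int[mu]_(x in `]0%R, 1%R[) (betaf (p' + 1) q' x)%:E + \int[mu]_(x in `]0%R, 1%R[) (betaf p' (q' + 1) x)%:E)%E.
  rewrite -ge0_integralD//.
  - by apply: eq_integral => x; rewrite inE => /betaf_split ->.
  - by move=> x _; rewrite lee_fin betaf_ge0.
  - by apply: measurable_oo_continuous => x; exact: continuous_betaf.
  - by move=> x _; rewrite lee_fin betaf_ge0.
  - by apply: measurable_oo_continuous => x; exact: continuous_betaf.
have fin11 : (\int[mu]_(x in `]0%R, 1%R[) (betaf (p + 1) (q + 1) x)%:E < +oo)%E.
  have : mu.-integrable `]0%R, 1%R[ (EFin \o betaf (p + 1) (q + 1)).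
    apply: (@integrable_oo_bounded R 0 1 1) => x xI; first exact: continuous_betaf.
    move: xI; rewrite in_itv/= => /andP[x0 x1]; rewrite ger0_norm ?betaf_ge0// /betaf !addrK.
    by rewrite mulr_ile1 ?powR_ge0// powR_le1 ?(ltW p0) ?(ltW q0)//; apply/andP; split; lra.
  by move=> /integrable_lty; apply.
have cancelfin (k : R) (A B : \bar R) : 0 < k -> (0 <= A)%E -> (k%:E * A = B -> B < +oo -> A < +oo)%E.
  by move=> k0; case: A => [A| |]// _ <-; rewrite ?ltry// gt0_muley ?lte_fin// ltxx.
have finM (k : R) (A : \bar R) : 0 < k -> (0 <= A -> A < +oo -> k%:E * A < +oo)%E.
  by move=> k0; case: A => [A| |]// _ _; rewrite -EFinM ltry.
have q1 : 0 < q + 1 by rewrite addr_gt0.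
have fin2 := cancelfin _ _ _ p0 (fin_ge0 _ _) (integral_betaf_by_parts p0 q1) (finM _ _ q1 (fin_ge0 _ _) fin11).
have finq : (\int[mu]_(x in `]0%R, 1%R[) (betaf p (q + 1) x)%:E < +oo)%E.
  by rewrite splitE lte_add_pinfty.
have finp := cancelfin _ _ _ q0 (fin_ge0 _ _) (esym (integral_betaf_by_parts p0 q0)) (finM _ _ p0 (fin_ge0 _ _) finq).
apply: integrable_oo_ge0; [by move=> x; exact: continuous_betaf|by move=> x _; exact: betaf_ge0|].
by rewrite splitE lte_add_pinfty.
Qed.

(** Eliminate B(p, q + 1) between B(p, q) = B(p + 1, q) + B(p, q + 1) and p B(p, q + 1) = q B(p + 1,
    q). *)
Lemma betaR_rec (p q : R) : 0 < p -> 0 < q -> (p + q) * betaR (p + 1) q = p * betaR p q.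
Proof.
move=> p0 q0.
have p1 : 0 < p + 1 by rewrite addr_gt0.
have q1 : 0 < q + 1 by rewrite addr_gt0.
have e1 : betaR p q = betaR (p + 1) q + betaR p (q + 1).
  rewrite /betaR -RintegralD//; [|exact: integrable_betaf..].
  by apply: eq_Rintegral => x; rewrite inE => /betaf_split.
have e2 : p * betaR p (q + 1) = q * betaR (p + 1) q.
  have iZ (k p' q' : R) : 0 < p' -> 0 < q' -> mu.-integrable `]0%R, 1%R[ (EFin \o (fun x => k * betaf p' q' x)).
    by move=> p'0 q'0; have h := integrable_betaf p'0 q'0; exact: (integrableZl _ k h).
  apply/eqP; rewrite -subr_eq0 /betaR -!RintegralZl//; [|exact: integrable_betaf..].
  rewrite -RintegralB//; [|exact: iZ..]; apply/eqP.
  rewrite -[RHS](subrr 0); apply: (@FTC_oo R 0 1 0 0 _ (betaf (p + 1) (q + 1)) ltr01).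
  - have h1 := iZ p p (q + 1) p0 q1; have h2 := iZ q (p + 1) q p1 q0; exact: (integrableB _ h1 h2).
  - by move=> x xI; apply: cvgB; apply: cvgM; [exact: cvg_cst|exact: continuous_betaf|exact: cvg_cst|exact: continuous_betaf].
  - by move=> x; exact: is_derive_betaf.
  - exact: cvg_betaf_right.
  - exact: cvg_betaf_left.
by rewrite mulrDl -e2 -mulrDr -e1.
Qed.

End beta.
Section gegenbauer.
Context (R : realType).
Notation mu := (@lebesgue_measure R).

Definition gegf (n : nat) (e x : R) : R := x ^+ n * (1 - x ^+ 2) `^ e.
Definition gegR (n : nat) (e : R) : R := (\int[mu]_(x in `](-1)%R, 1%R[) gegf n e x)%R.

Lemma one_sub_sqr_gt0 (x : R) : x \in `](-1), 1[ -> 0 < 1 - x ^+ 2.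
Proof. by rewrite in_itv/= => /andP[x0 x1]; nra. Qed.

Lemma is_derive_one_sub_sqr (x : R) : is_derive x 1 (fun y : R => 1 - y ^+ 2) (- (2 * x)).
Proof.
have h : is_derive x 1 (fun y : R => y ^+ 2) (2 * x).
  by have := is_derive_exprn 2 (is_derive_id x 1); rewrite mulr1 expr1.
by rewrite -sub0r; exact: is_deriveB.
Qed.

Lemma is_derive_gegf n (e x : R) : x \in `](-1), 1[ ->
  is_derive x 1 (gegf n.+1 (e + 1)) (n.+1%:R * gegf n (e + 1) x - 2 * (e + 1) * gegf n.+2 e x).
Proof.
move=> xI.
have h1 := is_derive_exprn n.+1 (is_derive_id x 1).
have h3 := @is_derive_powR R (fun y => 1 - y ^+ 2) x _ (e + 1) (one_sub_sqr_gt0 xI) (is_derive_one_sub_sqr x).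
apply: is_derive_eq (is_deriveM h1 h3) _.
by rewrite /gegf !addrK /GRing.scale/= !exprS; ring.
Qed.

Lemma is_derive_powR_one_sub_sqr (e x : R) : x \in `](-1), 1[ ->
  is_derive x 1 (fun y : R => (1 - y ^+ 2) `^ e) (- (2 * e) * gegf 1 (e - 1) x).
Proof.
move=> xI.
have h3 := @is_derive_powR R (fun y => 1 - y ^+ 2) x _ e (one_sub_sqr_gt0 xI) (is_derive_one_sub_sqr x).
by apply: is_derive_eq h3 _; rewrite /gegf expr1; ring.
Qed.

Lemma continuous_gegf n (e x : R) : x \in `](-1), 1[ -> {for x, continuous (gegf n e)}.
Proof.
move=> xI; apply: cvgM; first exact: exprn_continuous.
exact: is_derive_continuous (is_derive_powR_one_sub_sqr e xI).
Qed.

Lemma cvg_gegf_right n (e : R) : 0 < e + 1 -> gegf n (e + 1) x @[x --> (-1)^'+] --> 0.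
Proof.
move=> e0; rewrite -[X in _ --> X](mulr0 ((-1) ^+ n)); apply: cvgM.
  by apply: cvg_at_right_filter; exact: exprn_continuous.
apply: cvg_powR0 => //.
  apply: cvg_at_right_filter; have h := is_derive_continuous (is_derive_one_sub_sqr (-1)).
  by rewrite /prop_for /continuous_at sqrrN expr1n subrr in h.
near=> x; apply: one_sub_sqr_gt0; rewrite in_itv/=; apply/andP; split; near: x.
  exact: nbhs_right_gt.
by apply: nbhs_right_lt; lra.
Unshelve. all: end_near. Qed.

Lemma cvg_gegf_left n (e : R) : 0 < e + 1 -> gegf n (e + 1) x @[x --> 1^'-] --> 0.
Proof.
move=> e0; rewrite -[X in _ --> X](mulr0 (1 ^+ n)); apply: cvgM.
  by apply: cvg_at_left_filter; exact: exprn_continuous.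
apply: cvg_powR0 => //.
  apply: cvg_at_left_filter; have h := is_derive_continuous (is_derive_one_sub_sqr 1).
  by rewrite /prop_for /continuous_at expr1n subrr in h.
near=> x; apply: one_sub_sqr_gt0; rewrite in_itv/=; apply/andP; split; near: x.
  by apply: nbhs_left_gt; lra.
exact: nbhs_left_lt.
Unshelve. all: end_near. Qed.

Lemma gegf_step n (e x : R) : x \in `](-1), 1[ -> gegf n (e + 1) x = gegf n e x - gegf n.+2 e x.
Proof.
move=> xI; rewrite /gegf (powR_mulVr (e + 1) (one_sub_sqr_gt0 xI)) addrK !exprS; ring.
Qed.

(** Only -1 < e < 0 is delicate. Differentiating x (1 - x^2)^(e+1) compares the bounded case (0, e +
    1) with (2, e), both nonnegative; their sum is the case (0, e), which dominates every (n, e)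
    because |x| <= 1. *)
Lemma integrable_gegf n (e : R) : 0 < e + 1 -> mu.-integrable `](-1)%R, 1%R[ (EFin \o gegf n e).
Proof.
move=> e0.
have lt11 : -1 < 1 :> R by lra.
have ge0 k e' x : ~~ odd k -> 0 <= gegf k e' x.
  by move=> ok; rewrite mulr_ge0 ?powR_ge0// exprn_even_ge0.
have i1 k : mu.-integrable `](-1)%R, 1%R[ (EFin \o gegf k (e + 1)).
  apply: (@integrable_oo_bounded R (-1) 1 1) => x xI; first exact: continuous_gegf.
  have h := one_sub_sqr_gt0 xI; move: xI; rewrite in_itv/= => /andP[x0 x1].
  rewrite normrM mulr_ile1//.
    by rewrite normrX exprn_ile1// ler_norml !ltW.
  rewrite ger0_norm ?powR_ge0// powR_le1 ?(ltW e0)// (ltW h)/=.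
  by rewrite lerBlDr lerDl sqr_ge0.
have i2 : mu.-integrable `](-1)%R, 1%R[ (EFin \o gegf 2 e).
  apply: integrable_oo_ge0; [by move=> x; exact: continuous_gegf|by move=> x _; exact: ge0|].
  have H := @ge0_FTC_oo R (-1) 1 0 0 (gegf 0 (e + 1)) (fun x => 2 * (e + 1) * gegf 2 e x) (gegf 1 (e + 1)) lt11.
  have {H} : (\int[mu]_(x in `](-1)%R, 1%R[) (gegf 0 (e + 1) x)%:E + 0 =
      \int[mu]_(x in `](-1)%R, 1%R[) (2 * (e + 1) * gegf 2 e x)%:E + 0)%E.
    apply: H.
    - by move=> x _; exact: ge0.
    - by move=> x _; rewrite mulr_ge0 ?ge0// mulr_ge0// ltW.
    - by move=> x; exact: continuous_gegf.
    - by move=> x xI; apply: cvgM; [exact: cvg_cst|exact: continuous_gegf].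
    - by move=> x xI; have := is_derive_gegf 0 e xI; rewrite mul1r.
    - exact: cvg_gegf_right.
    - exact: cvg_gegf_left.
  rewrite !adde0 => H; have h0 := integrable_lty _ (i1 0); rewrite -/(EFin \o _) /comp in h0.
  have e2 : 0 < 2 * (e + 1) by rewrite mulr_gt0.
  have : (\int[mu]_(x in `](-1)%R, 1%R[) (2 * (e + 1) * gegf 2 e x)%:E < +oo)%E.
    by rewrite -H; exact: h0.
  have -> : (\int[mu]_(x in `](-1)%R, 1%R[) (2 * (e + 1) * gegf 2 e x)%:E =
      (2 * (e + 1))%:E * \int[mu]_(x in `](-1)%R, 1%R[) (gegf 2 e x)%:E)%E.
    rewrite -ge0_integralZl//; last by rewrite lee_fin ltW.
    + by apply: measurable_oo_continuous => x; exact: continuous_gegf.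
    + by move=> x _; rewrite lee_fin ge0.
  by case: (\int[_]_(_ in _) _)%E => [A| |] //; rewrite ?ltry// gt0_muley ?lte_fin// ltxx.
have i0 : mu.-integrable `](-1)%R, 1%R[ (EFin \o gegf 0 e).
  have i12 : mu.-integrable `](-1)%R, 1%R[ (EFin \o gegf 0 (e + 1) \+ (EFin \o gegf 2 e))%E.
    by have h1 := i1 0%N; exact: (integrableD _ h1 i2).
  apply: eq_integrable i12 => //.
  by move=> x xI /=; rewrite -EFinD gegf_step ?subrK//; rewrite inE in xI.
apply: le_integrable i0 => //; first by apply: measurable_oo_continuous => x; exact: continuous_gegf.
move=> x; rewrite /= in_itv/= => /andP[x0 x1]; rewrite lee_fin !normrM ler_wpM2r//.
by rewrite expr0 normr1 normrX exprn_ile1// ler_norml !ltW.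
Qed.

Lemma gegR_step n (e : R) : 0 < e + 1 -> gegR n (e + 1) = gegR n e - gegR n.+2 e.
Proof.
move=> e0; rewrite /gegR -RintegralB//; [|exact: integrable_gegf..].
by apply: eq_Rintegral => x; rewrite inE => /gegf_step.
Qed.

Lemma gegR_by_parts n (e : R) : 0 < e + 1 -> n.+1%:R * gegR n (e + 1) = 2 * (e + 1) * gegR n.+2 e.
Proof.
move=> e0; have e1 : 0 < e + 1 + 1 by rewrite addr_gt0.
have iZ (k : R) m e' : 0 < e' + 1 -> mu.-integrable `](-1)%R, 1%R[ (EFin \o (fun x => k * gegf m e' x)).
  by move=> e'0; have h := integrable_gegf m e'0; exact: (integrableZl _ k h).
have lt11 : -1 < 1 :> R by lra.
apply/eqP; rewrite -subr_eq0 /gegR -!RintegralZl//; [|exact: integrable_gegf..].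
rewrite -RintegralB//; [|exact: iZ..]; apply/eqP.
rewrite -[RHS](subrr 0); apply: (@FTC_oo R (-1) 1 0 0 _ (gegf n.+1 (e + 1)) lt11).
- have h1 := iZ n.+1%:R n (e + 1) e1; have h2 := iZ (2 * (e + 1)) n.+2 e e0; exact: (integrableB _ h1 h2).
- by move=> x xI; apply: cvgB; apply: cvgM; [exact: cvg_cst|exact: continuous_gegf|exact: cvg_cst|exact: continuous_gegf].
- by move=> x; exact: is_derive_gegf.
- exact: cvg_gegf_right.
- exact: cvg_gegf_left.
Qed.

(** Integration by parts and the splitting of (1 - x^2)^(e+1) are two linear relations among G(n,
    e), G(n + 2, e) and G(n, e + 1). Eliminating the last one gives this recurrence, eliminating the
    middle one gives [gegR_rec2]. *)
Lemma gegR_rec1 n (e : R) : 0 < e + 1 -> n.+1%:R * gegR n e = (n%:R + 2 * e + 3) * gegR n.+2 e.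
Proof.
move=> e0; have := gegR_by_parts n e0; rewrite gegR_step// -natr1 => h.
by apply/eqP; rewrite -subr_eq0; apply/eqP; move: h; lra.
Qed.

Lemma gegR_rec2 n (e : R) : 0 < e + 1 -> (n%:R + 2 * e + 3) * gegR n (e + 1) = 2 * (e + 1) * gegR n e.
Proof.
move=> e0; have := gegR_by_parts n e0; have := gegR_step n e0; rewrite -natr1 => h1 h2.
have -> : gegR n e = gegR n (e + 1) + gegR n.+2 e by rewrite h1; ring.
by lra.
Qed.

(** The integrand has the explicit antiderivative -(1 - x^2)^(e+1) / (2(e + 1)), zero at both ends.
    This is the one moment that self-adjointness needs and [gegR_rec1] does not reach. *)
Lemma gegR_1 (e : R) : 0 < e + 1 -> gegR 1 e = 0.
Proof.
move=> e0; have lt11 : -1 < 1 :> R by lra.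
rewrite -[RHS](subrr 0); apply: (@FTC_oo R (-1) 1 0 0 _ (fun x => - (2 * (e + 1))^-1 * gegf 0 (e + 1) x) lt11).
- exact: integrable_gegf.
- by move=> x; exact: continuous_gegf.
- move=> x xI; have h := is_derive_powR_one_sub_sqr (e + 1) xI.
  rewrite addrK in h; have hZ := is_deriveZ (- (2 * (e + 1))^-1) h.
  have -> : (fun x => - (2 * (e + 1))^-1 * gegf 0 (e + 1) x) = (- (2 * (e + 1))^-1) \*: (fun y : R => (1 - y ^+ 2) `^ (e + 1)).
    by apply/funext => y /=; rewrite /gegf expr0 mul1r.
  apply: is_derive_eq hZ _; rewrite /GRing.scale/=; field; lra.
- by rewrite -[X in _ --> X](mulr0 (- (2 * (e + 1))^-1)); apply: cvgM; [exact: cvg_cst|exact: cvg_gegf_right].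
- by rewrite -[X in _ --> X](mulr0 (- (2 * (e + 1))^-1)); apply: cvgM; [exact: cvg_cst|exact: cvg_gegf_left].
Qed.

End gegenbauer.
(** * Moments of the weight *)

Lemma ge0_even_integral (R : realType) (f : R -> \bar R) :
  measurable_fun [set: R] f -> (forall x, 0 <= f x)%E -> (forall x, f (- x) = f x) ->
  (\int[lebesgue_measure]_x f x = \int[lebesgue_measure]_(x in `[0%R, +oo[) f x +
    \int[lebesgue_measure]_(x in `[0%R, +oo[) f x)%E.
Proof.
move=> mf f0 fe.
have E : (\int[lebesgue_measure]_(x in `]-oo, 0%R[) f x = \int[lebesgue_measure]_(x in `[0%R, +oo[) f x)%E.
  rewrite ge0_integration_by_substitution0// integral_itv_bndo_bndc; last exact: measurable_funTS.
  by apply: eq_integral => x _; rewrite fe.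
transitivity (\int[lebesgue_measure]_(x in `]-oo, 0%R[) f x + \int[lebesgue_measure]_(x in `[0%R, +oo[) f x)%E; last by rewrite E.
rewrite -ge0_integral_setU//=.
- by congr (integral _ _ _); rewrite -setCitvr setvU.
- by apply: measurable_funTS.
- apply/disj_set2P; rewrite -subset0 => x [] /=; rewrite !in_itv/= andbT => x0.
  by rewrite leNgt x0.
Qed.

Section moments.
Context (R : realType) (a b c k2 k3 : R).
Hypotheses (a_ge0 : 0 <= a) (lt_ab : a < b) (c_ge0 : 0 <= c).
Hypotheses (k2_gt : - 2^-1 < k2) (k3_gt : -1 < k3).
Notation mu := (@lebesgue_measure R).
Notation RR := (measurableTypeR R * measurableTypeR R)%type.
Notation W := (weight a b c k2 k3).
Notation Om := (Omega a b c).

(* The square of the coordinate t of psi. *)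
Definition tau (p : R * R) : R := (- a + (a - c) * p.1 ^+ 2 + p.2 ^+ 2) / (b - a).

(** The last base of the weight is 1 - u^2 - tau: apart from |v|, the weight depends on (u, v) only
    through (u, tau), with no further trace of a, b, c. *)
Lemma weightE p : W p = `|p.2| * tau p `^ (k2 - 2^-1) * (1 - p.1 ^+ 2 - tau p) `^ k3.
Proof.
rewrite /weight /tau; congr (_ * _ `^ _); have : b - a != 0 by rewrite subr_eq0 gt_eqF.
by move=> h; field.
Qed.

Lemma weight_ge0 p : 0 <= W p.
Proof. by rewrite weightE !mulr_ge0 ?powR_ge0. Qed.

Lemma OmegaE p : Om p <-> [/\ `|p.1| <= 1, 0 <= tau p & 0 <= 1 - p.1 ^+ 2 - tau p].
Proof.
have h : 0 < b - a by rewrite subr_gt0.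
have -> : 1 - p.1 ^+ 2 - tau p = (b + (c - b) * p.1 ^+ 2 - p.2 ^+ 2) / (b - a).
  by rewrite /tau; field; rewrite gt_eqF.
rewrite /tau !pmulr_lge0 ?invr_gt0//; split=> [[h1 [h2 h3]]|[h1 h2 h3]]; split => //; last split; lra.
Qed.

Lemma tau_mem01 p : Om p -> 0 <= tau p <= 1.
Proof. by move=> /OmegaE[_ -> h] /=; have := sqr_ge0 p.1; lra. Qed.

Lemma measurable_tau : measurable_fun [set: RR] tau.
Proof.
have m1 : measurable_fun [set: RR] (fun p : RR => p.1 ^+ 2 : R).
  by apply: measurable_funX; exact: measurable_fst.
have m2 : measurable_fun [set: RR] (fun p : RR => p.2 ^+ 2 : R).
  by apply: measurable_funX; exact: measurable_snd.
by apply: measurable_funM => //; apply: measurable_funD => //; apply: measurable_funD => //; apply: measurable_funM.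
Qed.

Lemma measurable_cotau : measurable_fun [set: RR] (fun p : RR => 1 - p.1 ^+ 2 - tau p : R).
Proof.
apply: measurable_funB; last exact: measurable_tau.
apply: measurable_funB => //; apply: measurable_funX; exact: measurable_fst.
Qed.

Lemma measurable_weight : measurable_fun [set: RR] W.
Proof.
rewrite (funext weightE); apply: measurable_funM; first apply: measurable_funM.
- apply: measurableT_comp => //; exact: measurable_snd.
- apply: (measurableT_comp (measurable_powR _)); exact: measurable_tau.
- apply: (measurableT_comp (measurable_powR _)); exact: measurable_cotau.
Qed.

Lemma measurable_Omega : measurable (Om : set RR).
Proof.
have -> : Om = ((fun p : RR => `|p.1|) @^-1` `]-oo, 1]) `&`
   ((tau @^-1` `[0, +oo[) `&` ((fun p : RR => 1 - p.1 ^+ 2 - tau p) @^-1` `[0, +oo[)).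
  apply/seteqP; split=> p /=; rewrite !in_itv/= ?andbT; first by move=> /OmegaE[].
  by move=> [? [? ?]]; apply/OmegaE.
apply: measurableI; last apply: measurableI.
- rewrite -[X in measurable X]setTI; apply: measurableT_comp => //; exact: measurable_fst.
- rewrite -[X in measurable X]setTI; exact: measurable_tau.
- rewrite -[X in measurable X]setTI; exact: measurable_cotau.
Qed.

Definition momf (i j : nat) (p : R * R) : R := p.1 ^+ i * tau p ^+ j * W p.

Lemma measurable_momf i j : measurable_fun [set: RR] (momf i j).
Proof.
apply: measurable_funM; last exact: measurable_weight.
apply: measurable_funM; first by apply: measurable_funX; exact: measurable_fst.
by apply: measurable_funX; exact: measurable_tau.
Qed.

Lemma measurable_momf_Omega i j : measurable_fun [set: RR] ((EFin \o momf i j) \_ Om).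
Proof.
have mO := measurable_Omega; apply/(measurable_restrictT _ mO).
apply: measurable_funTS; apply/measurable_EFinP; exact: measurable_momf.
Qed.


(** * Integration over vertical sections of the region *)

Local Notation rr u := (1 - u ^+ 2).
Local Notation al u := (a + (c - a) * u ^+ 2).

(** The value is a (1 - u^2) + c u^2, a convex combination of a and c. *)
Lemma al_ge0 (u : R) : u \in `](-1), 1[ -> 0 <= al u.
Proof.
move=> uI; have := one_sub_sqr_gt0 uI; have := sqr_ge0 u; move: a_ge0 c_ge0; move: (u ^+ 2) => x *; nra.
Qed.

(** The upper bound b + (c - b) u^2 is rewritten as al u + (b - a)(1 - u^2), so that tau runs from 0
    to 1 - u^2 along the section. *)
Lemma Omega_section (u v : R) : u \in `](-1), 1[ -> 0 <= v ->
  Om (u, v) <-> (v \in `[Num.sqrt (al u), Num.sqrt (al u + (b - a) * rr u)]).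
Proof.
move=> uI v0; have al0 := al_ge0 uI; have r0 := one_sub_sqr_gt0 uI.
have be0 : 0 <= al u + (b - a) * rr u by rewrite addr_ge0// mulr_ge0 ?(ltW r0)// subr_ge0 ltW.
have u1 : `|u| <= 1 by move: uI; rewrite in_itv/= => /andP[? ?]; rewrite ler_norml !ltW.
have vE : v = Num.sqrt (v ^+ 2) by rewrite sqrtr_sqr ger0_norm.
rewrite in_itv/= {2 3}vE !ler_sqrt ?sqr_ge0// /Omega/=; split; first by move=> [_ [h1 h2]]; apply/andP; split; lra.
by move=> /andP[h1 h2]; split=> //; split; lra.
Qed.

Lemma tau_section (u v : R) : tau (u, v) = (v ^+ 2 - al u) / (b - a).
Proof. by rewrite /tau /=; congr (_ / _); ring. Qed.

Lemma tau_section_gt0 (u v : R) : u \in `](-1), 1[ ->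
  v \in `]Num.sqrt (al u), Num.sqrt (al u + (b - a) * rr u)[ ->
  [/\ 0 < v, 0 < tau (u, v) & 0 < rr u - tau (u, v)].
Proof.
move=> uI; have al0 := al_ge0 uI; have r0 := one_sub_sqr_gt0 uI.
rewrite in_itv/= => /andP[h1 h2]; have v0 : 0 < v by rewrite (le_lt_trans _ h1) ?sqrtr_ge0.
have vE : v = Num.sqrt (v ^+ 2) by rewrite sqrtr_sqr gtr0_norm.
have ba : 0 < b - a by rewrite subr_gt0.
have be0 : 0 < al u + (b - a) * rr u by rewrite ltr_wpDl// mulr_gt0.
rewrite vE ltr_sqrt ?exprn_gt0// in h1; rewrite vE ltr_sqrt// in h2.
have -> : rr u - tau (u, v) = (al u + (b - a) * rr u - v ^+ 2) / (b - a).
  by rewrite tau_section; field; rewrite gt_eqF.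
by rewrite tau_section !divr_gt0 ?subr_gt0//.
Qed.

Lemma is_derive_tau2 (u v : R) : is_derive v 1 (fun y => tau (u, y)) (2 * v / (b - a)).
Proof.
have h : is_derive v 1 (fun y : R => y ^+ 2) (2 * v).
  by have := is_derive_exprn 2 (is_derive_id v 1); rewrite mulr1 expr1.
have -> : (fun y => tau (u, y)) = (fun y => (b - a)^-1 * (y ^+ 2 - al u)).
  by apply/funext => y; rewrite tau_section mulrC.
have h2 : is_derive v 1 (fun y => y ^+ 2 - al u) (2 * v) by rewrite -[X in is_derive _ _ _ X]subr0; exact: is_deriveB.
by apply: is_derive_eq (is_deriveZ (b - a)^-1 h2) _; rewrite /GRing.scale/= mulrC.
Qed.

Lemma powR_mulX (y p : R) j : 0 < y -> y ^+ j * y `^ p = y `^ (j%:R + p).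
Proof. by move=> y0; rewrite powRD ?(gt_eqF y0) ?implybT// powR_mulrn// ltW. Qed.

Lemma powR_1DD (y p q : R) : 0 < y -> y `^ (1 + p + q) = y * y `^ p * y `^ q.
Proof. by move=> y0; rewrite !powRD ?(gt_eqF y0) ?implybT// powRr1// ltW. Qed.

(** Along a section |v| dv is (b - a)/2 dtau, and the two signs of v double it. Putting tau = (1 -
    u^2) x then leaves a Beta integral, while the powers of 1 - u^2 add up to [mome j]: j + k2 - 1/2
    from tau, k3 from 1 - u^2 - tau, and 1 from dtau. *)
Definition momc (j : nat) : R := (b - a) * betaR (j%:R + k2 + 2^-1) (k3 + 1).
Definition mome (j : nat) : R := j%:R + k2 + k3 + 2^-1.

(* The substitution v = sqrt (al u + (b - a) (1 - u^2) x) turns tau into (1 - u^2) x. *)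
Lemma integral_half_section (u : R) j : u \in `](-1), 1[ ->
  (\int[mu]_(v in `[0%R, +oo[) ((EFin \o momf 0 j) \_ Om) (u, v) =
   (2^-1 * momc j * rr u `^ mome j)%:E)%E.
Proof.
move=> uI; have al0 := al_ge0 uI; have r0 := one_sub_sqr_gt0 uI.
set A := Num.sqrt (al u); set B := Num.sqrt (al u + (b - a) * rr u).
pose G v := momf 0 j (u, v).
have cG (v : R) : v \in `]A, B[ -> {for v, continuous G}.
  move=> /(tau_section_gt0 uI)[v0 t0 t1].
  have dt := is_derive_tau2 u v.
  have dt' : is_derive v 1 (fun y => rr u - tau (u, y)) (- (2 * v / (b - a))).
    by rewrite -[X in is_derive _ _ _ X]sub0r; exact: is_deriveB.
  have -> : G = (fun v => tau (u, v) ^+ j * (`|v| * tau (u, v) `^ (k2 - 2^-1) * (rr u - tau (u, v)) `^ k3)).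
    by apply/funext => y; rewrite /G /momf expr0 mul1r weightE.
  apply: cvgM; first exact: (is_derive_continuous (is_derive_exprn j dt)).
  apply: cvgM; last exact: (is_derive_continuous (@is_derive_powR R _ v _ k3 t1 dt')).
  apply: cvgM; first exact: norm_continuous.
  exact: (is_derive_continuous (@is_derive_powR R _ v _ (k2 - 2^-1) t0 dt)).
(* The indicator of [Omega] cuts the half line to [A, B]; the two endpoints, where the integrand may
   be singular, are discarded as a null set. *)
have -> : (\int[mu]_(v in `[0%R, +oo[) ((EFin \o momf 0 j) \_ Om) (u, v) = \int[mu]_(v in `]A, B[) (G v)%:E)%E.
  rewrite -(@integral_itv_bndoo R A B (EFin \o G) true false); last exact: measurable_oo_continuous.
  rewrite [LHS]integral_mkcond [RHS]integral_mkcond; congr (integral _ _ _); apply/funext => v.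
  rewrite /patch !mem_setE; case: ifPn => v0.
    have v0' : 0 <= v by move: v0; rewrite in_itv/= andbT.
    have := Omega_section uI v0'; rewrite -/A -/B.
    case: ifPn; rewrite ?inE.
    - by move=> hO [/(_ hO) -> _].
    - by rewrite notin_setE => hO [_ H]; case: ifPn => // /H.
  case: ifPn => //; move: v0; rewrite !in_itv/= andbT -ltNge => v0 /andP[h _].
  by have := le_lt_trans h v0; rewrite ltNge sqrtr_ge0.
pose F x := Num.sqrt (al u + (b - a) * rr u * x).
have Fin (x : R) : x \in `]0, 1[ -> 0 < al u + (b - a) * rr u * x.
  by rewrite in_itv/= => /andP[x0 x1]; rewrite ltr_wpDl// !mulr_gt0// subr_gt0.
have dF (x : R) : x \in `]0, 1[ -> is_derive x 1 F ((b - a) * rr u / (2 * F x)).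
  move=> /Fin h.
  have h2 : is_derive x 1 (fun x => al u + (b - a) * rr u * x) ((b - a) * rr u).
    have hZ := is_deriveZ ((b - a) * rr u) (is_derive_id x 1).
    rewrite -[X in is_derive _ _ _ X]add0r -[X in is_derive _ _ _ (_ + X)]mulr1.
    exact: is_deriveD.
  exact: (@is_derive_sqrt R (fun x => al u + (b - a) * rr u * x) x _ h h2).
have F0 (x : R) : x \in `]0, 1[ -> 0 < F x by move=> /Fin; rewrite sqrtr_gt0.
have cF (x : R) : {for x, continuous F}.
  apply: (@continuous_comp _ _ _ (fun x => al u + (b - a) * rr u * x) Num.sqrt); last exact: sqrt_continuous.
  by apply: cvgD; [exact: cvg_cst|apply: cvgM; [exact: cvg_cst|exact: cvg_id]].
rewrite (@ge0_substitution_oo R 0 1 A B F (fun x => (b - a) * rr u / (2 * F x)) G ltr01 dF).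
- have P0 : 0 < j%:R + k2 + 2^-1 by have h := k2_gt; have j0 := ler0n R j; lra.
  have Q0 : 0 < k3 + 1 by have h := k3_gt; lra.
  have hi := integrable_betaf P0 Q0.
  (* The factor |v| of the weight cancels the [F x] in the denominator of the derivative, and the
     powers of 1 - u^2 separate from those of x. *)
  transitivity (\int[mu]_(x in `]0%R, 1%R[) ((2^-1 * (b - a) * rr u `^ mome j)%:E * (EFin \o betaf (j%:R + k2 + 2^-1) (k3 + 1)) x))%E.
    apply: eq_integral => x; rewrite inE/= => xI; have f0 := F0 x xI.
    have tE : tau (u, F x) = rr u * x.
      by rewrite tau_section sqr_sqrtr ?(ltW (Fin x xI))//; field; rewrite subr_eq0 gt_eqF.
    move: xI; rewrite in_itv/= => /andP[x0 x1].
    rewrite -EFinM; congr EFin; rewrite /G /momf expr0 mul1r weightE tE /= gtr0_norm//.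
    have -> : rr u - rr u * x = rr u * (1 - x) by ring.
    rewrite exprMn !powRM ?(ltW r0) ?(ltW x0) ?subr_ge0 ?(ltW x1)// /betaf addrK.
    have -> : mome j = 1 + (j%:R + (k2 - 2^-1)) + k3 by rewrite /mome; lra.
    have -> : j%:R + k2 + 2^-1 - 1 = j%:R + (k2 - 2^-1) by lra.
    have hR : rr u `^ (1 + (j%:R + (k2 - 2^-1)) + k3) = rr u * (rr u ^+ j * rr u `^ (k2 - 2^-1)) * rr u `^ k3.
      by rewrite powR_mulX// powR_1DD.
    by rewrite hR -(powR_mulX _ _ x0); field; rewrite gt_eqF.
  rewrite integralZl//.
  have -> : (\int[mu]_(x in `]0%R, 1%R[) (EFin \o betaf (j%:R + k2 + 2^-1) (k3 + 1)) x = (betaR (j%:R + k2 + 2^-1) (k3 + 1))%:E)%E.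
    by rewrite /betaR /Rintegral fineK//; exact: (integrable_fin_num _ hi).
  by rewrite -EFinM /momc; congr EFin; ring.
- move=> x xI; apply: cvgM; first exact: cvg_cst.
  apply: cvgV; first by rewrite mulf_neq0// gt_eqF// F0.
  by apply: cvgM; [exact: cvg_cst|exact: cF].
- move=> x /F0 h; rewrite divr_ge0 ?mulr_ge0 ?(ltW h) ?(ltW r0)// subr_ge0 ltW//.
- move=> x y xI yI xy; rewrite ltr_sqrt ?Fin// ltrD2l ltr_pM2l// mulr_gt0// subr_gt0//.
- have -> : A = F 0 by rewrite /F mulr0 addr0.
  by apply: cvg_at_right_filter; exact: cF.
- have -> : B = F 1 by rewrite /F mulr1.
  by apply: cvg_at_left_filter; exact: cF.
- move=> x /(tau_section_gt0 uI)[_ /ltW t0 _].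
  by rewrite /G /momf expr0 mul1r mulr_ge0 ?weight_ge0// exprn_ge0.
- exact: cG.
Qed.

Lemma momf0_ge0 j p : Om p -> 0 <= momf 0 j p.
Proof.
move=> /OmegaE[_ t0 _]; rewrite /momf expr0 mul1r mulr_ge0 ?weight_ge0// exprn_ge0//.
Qed.

Lemma momf_Omega_ge0 j p : (0 <= ((EFin \o momf 0 j) \_ Om) p)%E.
Proof. by rewrite /patch; case: ifPn => // /set_mem h; rewrite lee_fin momf0_ge0. Qed.

Lemma measurable_momf_section i j (u : R) : measurable_fun [set: measurableTypeR R] (fun v => ((EFin \o momf i j) \_ Om) (u, v)).
Proof. exact: (measurableT_comp (measurable_momf_Omega i j) (pair1_measurable u)). Qed.

Lemma integral_section (u : R) j : u \in `](-1), 1[ ->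
  (\int[mu]_v ((EFin \o momf 0 j) \_ Om) (u, v) = (momc j * rr u `^ mome j)%:E)%E.
Proof.
move=> uI; rewrite ge0_even_integral.
- by rewrite integral_half_section// -EFinD; congr EFin; field.
- exact: measurable_momf_section.
- by move=> v; exact: momf_Omega_ge0.
- move=> v; rewrite /patch; congr (if _ then _ else _).
    by apply/idP/idP => /set_mem h; apply/mem_set; move: h; rewrite /Omega/= sqrrN.
  by rewrite /= /momf /weight /tau /= sqrrN normrN.
Qed.

Lemma integral_section_out (u : R) i j : 1 < `|u| ->
  (\int[mu]_v ((EFin \o momf i j) \_ Om) (u, v) = 0)%E.
Proof.
move=> u1; apply: integral0_eq => v _; rewrite /patch; case: ifPn => // /set_mem [/=].
by rewrite leNgt u1.
Qed.

(** The values u = 1 and u = -1, where nothing is known about [H], form a null set. *)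
Lemma integral_sections (H : R -> \bar R) (K : R -> R) : measurable_fun [set: R] H ->
  (forall u, 1 < `|u| -> H u = 0%E) ->
  (forall u, u \in `](-1), 1[ -> H u = (K u)%:E) ->
  (\int[mu]_u H u = \int[mu]_(u in `](-1)%R, 1%R[) (K u)%:E)%E.
Proof.
move=> mH H0 HK.
transitivity (\int[mu]_(u in `[(-1)%R, 1%R]) H u)%E.
  rewrite [RHS]integral_mkcond; apply: eq_integral => u _; rewrite /patch mem_setE in_itv/=.
  by rewrite -ler_norml; case: ifPn => //; rewrite -ltNge => /H0.
rewrite (@integral_itv_bndoo R _ _ _ true false); last exact: measurable_funTS.
by apply: eq_integral => u; rewrite inE/= => /HK.
Qed.

Lemma mome_gt0 j : 0 < mome j + 1.
Proof. by have h2 := k2_gt; have h3 := k3_gt; have j0 := ler0n R j; rewrite /mome; lra. Qed.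

Notation mu2 := ((@lebesgue_measure R) \x (@lebesgue_measure R))%E.

(** [momf 0 0] is the weight itself. By Tonelli its integral reduces to a Gegenbauer integral,
    finite because [mome 0 + 1] is positive. *)
Lemma integrable_weight : mu2.-integrable [set: RR] ((EFin \o momf 0 0) \_ Om).
Proof.
apply/integrable12ltyP; first exact: measurable_momf_Omega.
have E u : (\int[mu]_v `|((EFin \o momf 0 0) \_ Om) (u, v)|)%E = (\int[mu]_v ((EFin \o momf 0 0) \_ Om) (u, v))%E.
  by apply: eq_integral => v _; rewrite gee0_abs// momf_Omega_ge0.
under eq_integral do rewrite E.
rewrite (@integral_sections _ (fun u => momc 0 * gegf 0 (mome 0) u)).
- have h := integrable_gegf 0 (mome_gt0 0); have h2 := integrableZl _ (momc 0) h.
  exact: (integrable_lty _ (h2 _)).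
- have h := measurable_momf_Omega 0 0; exact: (measurable_fun_fubini_tonelli_F _ h (momf_Omega_ge0 0)).
- by move=> u; exact: integral_section_out.
- by move=> u /(integral_section 0) ->; rewrite /gegf expr0 mul1r.
Qed.

(** On [Omega] both |u| and tau are at most 1, so the weight dominates. *)
Lemma integrable_momf i j : mu2.-integrable Om (EFin \o momf i j).
Proof.
have mO := measurable_Omega; apply/(integrable_mkcond _ mO).
apply: le_integrable integrable_weight => //; first exact: measurable_momf_Omega.
move=> p _; rewrite /patch; case: ifPn => // /set_mem pO; rewrite lee_fin /momf !normrM ler_wpM2r//.
have [p1 _ _] := (OmegaE p).1 pO; have /andP[t0 t1] := tau_mem01 pO.
by rewrite !expr0 !normr1 mulr1 mulr_ile1// normrX exprn_ile1// ger0_norm.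
Qed.

Definition mom i j : R := (\int[mu2]_(p in Om) momf i j p)%R.

Lemma momE i j : mom i j = momc j * gegR i (mome j).
Proof.
have mO := measurable_Omega; have hi := (integrable_mkcond _ mO).1 (integrable_momf i j).
rewrite /mom /Rintegral [X in fine X]integral_mkcond -integral12_prod_meas1//.
rewrite (@integral_sections _ (fun u => momc j * gegf i (mome j) u)).
- have h := integrable_gegf i (mome_gt0 j).
  rewrite /gegR -RintegralZl//.
- exact: measurable_fubini_F hi.
- by move=> u; exact: integral_section_out.
- move=> u uI; rewrite /fubini_F.
  have hs : mu.-integrable [set: R] (fun v => ((EFin \o momf 0 j) \_ Om) (u, v)).
    apply/integrableP; split; first exact: measurable_momf_section.
    under eq_integral do rewrite gee0_abs ?momf_Omega_ge0//.
    by rewrite integral_section// ltry.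
  transitivity (\int[mu]_v ((u ^+ i)%:E * ((EFin \o momf 0 j) \_ Om) (u, v)))%E.
    apply: eq_integral => v _; rewrite /patch; case: ifPn => _; last by rewrite mule0.
    by rewrite -EFinM /momf /= expr0; congr EFin; ring.
  by rewrite integralZl// integral_section// -EFinM /gegf; congr EFin; ring.
Qed.

Lemma mom_rec1 i j : i.+1%:R * mom i j = (i%:R + 2 * j%:R + 4 + 2 * k2 + 2 * k3) * mom i.+2 j.
Proof.
rewrite !momE mulrCA gegR_rec1 ?mome_gt0// /mome mulrCA; congr (_ * (_ * _)); lra.
Qed.

Lemma mom_1 j : mom 1 j = 0.
Proof. by rewrite momE gegR_1 ?mulr0// mome_gt0. Qed.

(** Raising j shifts the first Beta parameter and the Gegenbauer exponent at once. The two
    recurrences combine because the sum of the Beta parameters is exactly [mome j + 1], the factor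
    produced by [gegR_rec2]. *)
Lemma mom_rec2 i j : (2 * j%:R + 1 + 2 * k2) * mom i j =
  (2 * j%:R + i%:R + 4 + 2 * k2 + 2 * k3) * mom i j.+1.
Proof.
rewrite !momE.
have e0 := mome_gt0 j; have eS : mome j.+1 = mome j + 1 by rewrite /mome -natr1; ring.
have P0 : 0 < j%:R + k2 + 2^-1 by have h := k2_gt; have j0 := ler0n R j; lra.
have Q0 : 0 < k3 + 1 by have h := k3_gt; lra.
have hB := betaR_rec P0 Q0; have hG := gegR_rec2 i e0.
rewrite eS /momc; have -> : j.+1%:R + k2 + 2^-1 = j%:R + k2 + 2^-1 + 1 by rewrite -natr1; ring.
have -> : 2 * j%:R + i%:R + 4 + 2 * k2 + 2 * k3 = i%:R + 2 * mome j + 3 by rewrite /mome; lra.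
set B1 := betaR (_ + 1) _ in hB *; set G1 := gegR _ (_ + 1) in hG *.
rewrite [RHS](_ : _ = (b - a) * B1 * ((i%:R + 2 * mome j + 3) * G1)); last by ring.
rewrite hG.
rewrite [RHS](_ : _ = 2 * (b - a) * ((mome j + 1) * B1) * gegR i (mome j)); last by ring.
have -> : mome j + 1 = j%:R + k2 + 2^-1 + (k3 + 1) by rewrite /mome; lra.
by rewrite hB; field.
Qed.

End moments.
(** * Polynomials presented as lists of monomials *)

Section spans.
Context (R : realType).
Implicit Types (X Y Z : R * R -> R) (s t : seq (R * nat * nat)) (w n : nat).

(* A list of triples (d, i, j) stands for the polynomial sum of d X^i Y^j. *)
Definition evalseq X Y s (p : R * R) : R := \sum_(m <- s) m.1.1 * X p ^+ m.1.2 * Y p ^+ m.2.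

(** [Y] counts with weight [w] in the degree: w = 1 for the pair (u, v), w = 2 for (u, tau), tau
    being quadratic. Lists are not reduced, so one function has many representations, compared only
    by evaluation. *)
Definition spanned w X Y n Z : Prop :=
  exists2 s, all (fun m => m.1.2 + w * m.2 <= n)%N s & forall p, Z p = evalseq X Y s p.

Lemma ev_cat X Y s t p : evalseq X Y (s ++ t) p = evalseq X Y s p + evalseq X Y t p.
Proof. by rewrite /evalseq big_cat. Qed.

Lemma ev_cons X Y m s p : evalseq X Y (m :: s) p = m.1.1 * X p ^+ m.1.2 * Y p ^+ m.2 + evalseq X Y s p.
Proof. by rewrite /evalseq big_cons. Qed.

Definition scale_seq (k : R) s : seq (R * nat * nat) := [seq (k * m.1.1, m.1.2, m.2) | m <- s].

Lemma ev_scale X Y k s p : evalseq X Y (scale_seq k s) p = k * evalseq X Y s p.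
Proof. by rewrite /evalseq big_map mulr_sumr; apply: eq_bigr => m _; rewrite /= !mulrA. Qed.

Definition mul_seq s t : seq (R * nat * nat) :=
  [seq (m.1.1 * m'.1.1, (m.1.2 + m'.1.2)%N, (m.2 + m'.2)%N) | m <- s, m' <- t].

Lemma ev_mul X Y s t p : evalseq X Y (mul_seq s t) p = evalseq X Y s p * evalseq X Y t p.
Proof.
rewrite /evalseq big_allpairs_dep /= mulr_suml; apply: eq_bigr => m _; rewrite mulr_sumr.
by apply: eq_bigr => m' _; rewrite !exprD; ring.
Qed.

Section closure.
Variables (w : nat) (X Y : R * R -> R).
Notation span := (spanned w X Y).

Lemma spanned_eq n Z Z' : (forall p, Z p = Z' p) -> span n Z -> span n Z'.
Proof. by move=> ZZ' [s hs Zs]; exists s => // p; rewrite -ZZ'. Qed.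

Lemma spanned_le n n' Z : (n <= n')%N -> span n Z -> span n' Z.
Proof.
move=> nn' [s hs Zs]; exists s => //; apply: sub_all hs => m h; exact: leq_trans nn'.
Qed.

Lemma spanned0 n : span n (fun=> 0).
Proof. by exists [::] => // p; rewrite /evalseq big_nil. Qed.

Lemma spannedD n Z Z' : span n Z -> span n Z' -> span n (fun p => Z p + Z' p).
Proof.
move=> [s hs Zs] [t ht Zt]; exists (s ++ t); first by rewrite all_cat hs.
by move=> p; rewrite ev_cat Zs Zt.
Qed.

Lemma spannedZ n k Z : span n Z -> span n (fun p => k * Z p).
Proof.
move=> [s hs Zs]; exists (scale_seq k s); last by move=> p; rewrite ev_scale Zs.
by rewrite all_map.
Qed.

Lemma spannedM n n' Z Z' : span n Z -> span n' Z' -> span (n + n') (fun p => Z p * Z' p).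
Proof.
move=> [s hs Zs] [t ht Zt]; exists (mul_seq s t); last by move=> p; rewrite ev_mul Zs Zt.
apply/allP => _ /allpairsP[[m m'] /= [ms m't ->]] /=.
by have := allP hs _ ms; have := allP ht _ m't; lia.
Qed.

Lemma spanned_mono n c i j : (i + w * j <= n)%N -> span n (fun p => c * X p ^+ i * Y p ^+ j).
Proof.
by move=> h; exists [:: (c, i, j)]; [rewrite /= h|move=> p; rewrite /evalseq big_seq1].
Qed.

Lemma spannedX n k Z : span n Z -> span (k * n) (fun p => Z p ^+ k).
Proof.
move=> hZ; elim: k => [|k IH].
  by apply: (spanned_eq _ (@spanned_mono 0 1 0 0 _)) => [p|]; rewrite ?expr0 ?mulr1 ?muln0.
by rewrite mulSn; apply: (spanned_eq _ (spannedM hZ IH)) => p; rewrite exprS.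
Qed.

Lemma spanned_sum n (I : Type) (r : seq I) (P : pred I) (F : I -> R * R -> R) :
  (forall i, P i -> span n (F i)) -> span n (fun p => \sum_(i <- r | P i) F i p).
Proof.
move=> h; elim: r => [|i r IH]; first by apply: (spanned_eq _ (spanned0 n)) => p; rewrite big_nil.
apply: (@spanned_eq _ (fun p => (if P i then F i p else 0) + \sum_(i <- r | P i) F i p)).
  by move=> p; rewrite big_cons; case: ifP => // _; rewrite add0r.
by apply: spannedD => //; case: (boolP (P i)) => [/h|_] //; exact: spanned0.
Qed.

End closure.

(** Substituting for [Y] a polynomial of degree at most its weight does not raise the degree. *)
Lemma spanned_trans w X Y w' X' Y' n Z : (0 < w)%N -> spanned w' X' Y' 1 X -> spanned w' X' Y' w Y ->
  spanned w X Y n Z -> spanned w' X' Y' n Z.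
Proof.
move=> w0 hX hY [s hs Zs].
suff : spanned w' X' Y' n (evalseq X Y s) by apply: spanned_eq => p; rewrite Zs.
elim: s hs {Zs} => [_|m s IH /= /andP[hm /IH hs]].
  by apply: (spanned_eq _ (spanned0 _ _ _ n)) => p; rewrite /evalseq big_nil.
apply: (@spanned_eq _ _ _ _ (fun p => m.1.1 * (X p ^+ m.1.2 * Y p ^+ m.2) + evalseq X Y s p)).
  by move=> p; rewrite /evalseq big_cons mulrA.
apply: spannedD hs; apply: spannedZ.
apply: spanned_le (spannedM (spannedX m.1.2 hX) (spannedX m.2 hY)).
by rewrite muln1 [(m.2 * w)%N]mulnC.
Qed.

Lemma spanned_poly2_le n Z : spanned 1 fst snd n Z -> poly2_le n Z.
Proof.
move=> [s hs Zs].
suff [coef hc] : poly2_le n (evalseq fst snd s) by exists coef => p; rewrite Zs.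
elim: s hs {Zs} => [_|[[c k] l] s IH /= /andP[hm /IH[coef hc]]].
  exists (fun _ _ => 0) => p; rewrite /evalseq big_nil big1// => i _; rewrite big1// => j _.
  by rewrite !mul0r.
(* Prepending a monomial adds a Kronecker delta to the coefficient family; the degree bound places
   its index in the range of the double sum. *)
exists (fun i j => c * (i == k)%:R * (j == l)%:R + coef i j) => p.
rewrite {1}/evalseq big_cons -/(evalseq fst snd s p) hc /=.
have hk : (k < n.+1)%N by lia.
have hl : (l < n.+1 - k)%N by lia.
under [RHS]eq_bigr => i _ do under eq_bigr => j _ do rewrite mulrDl mulrDl.
under [RHS]eq_bigr => i _ do rewrite big_split /=.
rewrite big_split /=; congr (_ + _).
rewrite (bigD1 (Ordinal hk))//= [X in _ = _ + X]big1 ?addr0; last first.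
  move=> i ik; rewrite big1// => j _.
  by rewrite -(inj_eq val_inj) /= in ik; rewrite (negbTE ik) mulr0 !mul0r.
rewrite (bigD1 (Ordinal hl))//= [X in _ = _ + X]big1 ?addr0; last first.
  move=> j jl.
  by rewrite -(inj_eq val_inj) /= in jl; rewrite (negbTE jl) mulr0 !mul0r.
by rewrite !eqxx !mulr1.
Qed.

End spans.

Section even_polynomials.
Context (R : realType) (a b c : R).
Hypothesis lt_ab : a < b.
Notation tau := (tau a b c).

Lemma tau_poly : spanned 1 fst snd 2 tau.
Proof.
exists [:: (- a / (b - a), 0%N, 0%N); ((a - c) / (b - a), 2%N, 0%N); ((b - a)^-1, 0%N, 2%N)] => // p.
by rewrite /evalseq !big_cons big_nil /tau /= !expr0; ring.
Qed.

Lemma sqr_snd_even : spanned 2 fst tau 2 (fun p => p.2 ^+ 2).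
Proof.
exists [:: (b - a, 0%N, 1%N); (a, 0%N, 0%N); (c - a, 2%N, 0%N)] => // p.
rewrite /evalseq !big_cons big_nil /tau /= !expr0 expr1; field.
by rewrite subr_eq0 gt_eqF.
Qed.

(** Averaging Y(u, v) with Y(u, -v) cancels the odd powers of v, without any appeal to uniqueness of
    the coefficients; even powers are then rewritten through v^2 = a + (c - a) u^2 + (b - a) tau. *)
Lemma even_poly2_spanned n Y : poly2_le n Y -> (forall p, Y (p.1, - p.2) = Y p) ->
  spanned 2 fst tau n Y.
Proof.
move=> [coef hY] eY.
have E p : \sum_(i < n.+1) \sum_(j < n.+1 - i | ~~ odd j) coef i j * p.1 ^+ i * (p.2 ^+ 2) ^+ j./2 = Y p.
  have -> : Y p = 2^-1 * (Y p + Y (p.1, - p.2)) by rewrite eY; field.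
  rewrite !hY -big_split /= mulr_sumr; apply: eq_bigr => i _.
  rewrite -big_split /= mulr_sumr [RHS](bigID (fun j : 'I_ _ => odd j)) /=.
  rewrite [X in _ = X + _]big1 ?add0r; last first.
    by move=> j oj; rewrite exprNn -signr_odd oj; ring.
  apply: eq_bigr => j oj; rewrite exprNn -signr_odd (negbTE oj) expr0 mul1r -exprM mul2n.
  have -> : (j./2.*2)%N = j :> nat by rewrite -[RHS]odd_double_half (negbTE oj).
  by field.
apply: (spanned_eq E); apply: spanned_sum => i _; apply: spanned_sum => j _.
apply: (@spanned_le _ _ _ _ (i + j./2 * 2)).
  by have := ltn_ord i; have := ltn_ord j; have := odd_double_half j; lia.
apply: spannedM; last exact: spannedX sqr_snd_even.
apply: (spanned_eq _ (@spanned_mono _ 2 fst tau i (coef i j) i 0 _)) => [p|].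
  by rewrite expr0 mulr1.
by rewrite muln0 addn0.
Qed.

Lemma spanned_even_poly n Z : spanned 2 fst tau n Z -> poly2_le n Z.
Proof.
move=> h; apply: spanned_poly2_le; apply: spanned_trans h => //; last exact: tau_poly.
by exists [:: (1, 1%N, 0%N)] => // p; rewrite /evalseq big_seq1 expr0 /= mul1r mulr1 expr1.
Qed.

End even_polynomials.
(** * Self-adjointness on even polynomials *)

Section operator.
Context (R : realType) (a b c k2 k3 : R).
Hypotheses (a_ge0 : 0 <= a) (lt_ab : a < b) (c_ge0 : 0 <= c).
Hypotheses (k2_gt : - 2^-1 < k2) (k3_gt : -1 < k3).
Implicit Types (s t : seq (R * nat * nat)).
Notation tau := (tau a b c).
Notation W := (weight a b c k2 k3).
Notation Om := (Omega a b c).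
Notation mom := (mom a b c k2 k3).
Notation ev := (evalseq fst tau).
Notation mu2 := ((@lebesgue_measure R) \x (@lebesgue_measure R))%E.
Notation RR := (measurableTypeR R * measurableTypeR R)%type.

Definition eigenval (n : nat) : R := n%:R * (n%:R + 2 * k2 + 2 * k3 + 2).

(* In the coordinates (u, tau) the operator sends u^i tau^j to
   i(i-1) u^(i-2) tau^j - eigenval(i+2j) u^i tau^j + 2j(2j-1+2k2) u^i tau^(j-1);
   when i < 2 or j = 0 the truncated exponents come with a zero coefficient. *)
Definition op_mono (m : R * nat * nat) : seq (R * nat * nat) :=
  let: (d, i, j) := m in
  [:: (d * (i%:R * (i%:R - 1)), i.-2, j); (- d * eigenval (i + 2 * j), i, j);
      (d * (2 * j%:R * (2 * j%:R - 1 + 2 * k2)), i, j.-1)].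

Definition op_seq s := flatten (map op_mono s).

Definition momseq s : R := \sum_(m <- s) m.1.1 * mom m.1.2 m.2.

Lemma integrable_ev s : mu2.-integrable (Om : set RR) (EFin \o (fun p => ev s p * W p)).
Proof.
have mO := measurable_Omega c lt_ab.
elim: s => [|[[d i] j] s IH].
  have -> : EFin \o (fun p => ev [::] p * W p) = cst 0%E.
    by apply/funext => p /=; rewrite /evalseq big_nil mul0r.
  exact: integrable0.
have h := integrable_momf a_ge0 lt_ab c_ge0 k2_gt k3_gt i j.
have h2 := integrableZl mO d h; have h3 := integrableD mO h2 IH.
apply: eq_integrable h3 => // p _ /=.
by rewrite -EFinM -EFinD; congr EFin; rewrite ev_cons /momf /=; ring.
Qed.

Lemma Rintegral_ev s : (\int[mu2]_(p in Om) (ev s p * W p))%R = momseq s.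
Proof.
have mO := measurable_Omega c lt_ab.
elim: s => [|[[d i] j] s IH].
  rewrite /momseq big_nil; under eq_Rintegral => p _ do rewrite /evalseq big_nil mul0r.
  by rewrite /Rintegral integral0.
have h := integrable_momf a_ge0 lt_ab c_ge0 k2_gt k3_gt i j.
have h2 := integrableZl mO d h.
rewrite /momseq big_cons -/(momseq s) -IH /= /mom -RintegralZl// -RintegralD//; last exact: integrable_ev.
by apply: eq_Rintegral => p _; rewrite ev_cons /momf /=; ring.
Qed.

(** The common coefficient of both recurrences once they are shifted to end at [mom i j]: (i - 1)
    mom(i-2, j) = E i j mom(i, j) for i >= 2, and (2j - 1 + 2 k2) mom(i, j-1) = E i j mom(i, j) for
    j >= 1. *)
Let E i j : R := i%:R + 2 * j%:R + 2 + 2 * k2 + 2 * k3.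

(** When i + k >= 2 both terms involve the moment of index i + k - 2, and i(i-1) - k(k-1) = (i -
    k)(i + k - 1) meets the first recurrence. A truncated exponent always has coefficient zero. In
    the remaining case i + k = 1 the right side vanishes by [mom_1]. *)
Lemma selfadj_i (i k J : nat) :
  i%:R * (i%:R - 1) * mom (i.-2 + k) J - k%:R * (k%:R - 1) * mom (i + k.-2) J =
  (i%:R - k%:R) * E (i + k) J * mom (i + k) J.
Proof.
have h0 m : (m < 2)%N -> m%:R * (m%:R - 1) = 0 :> R.
  by case: m => [|[|m]]//= _; rewrite ?mul0r ?subrr ?mulr0.
have key (A : R) : (2 <= i + k)%N -> mom (i + k).-2 J = A -> 
   (i%:R * (i%:R - 1) - k%:R * (k%:R - 1)) * A = (i%:R - k%:R) * E (i + k) J * mom (i + k) J.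
  move=> ik2 <-; have := mom_rec1 a_ge0 lt_ab c_ge0 k2_gt k3_gt (i + k).-2 J.
  have -> : ((i + k).-2.+2 = i + k)%N by lia.
  have hN : i%:R + k%:R = (i + k).-2%:R + 2 :> R.
    have e : (i + k = (i + k).-2 + 2)%N by lia.
    by rewrite -natrD {1}e natrD.
  have -> : (i + k).-2.+1%:R = i%:R + k%:R - 1 :> R by rewrite hN -natr1; ring.
  have -> : (i + k).-2%:R = i%:R + k%:R - 2 :> R by rewrite hN; ring.
  move=> h.
  have -> : i%:R * (i%:R - 1) - k%:R * (k%:R - 1) = (i%:R - k%:R) * (i%:R + k%:R - 1) :> R by ring.
  rewrite -mulrA h /E natrD; ring.
have [ik2|ik2] := leqP 2 (i + k).
  rewrite -(key _ ik2 erefl) mulrBl; congr (_ - _).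
    by have [i2|/h0->] := leqP 2 i; [congr (_ * mom _ _); lia|rewrite !mul0r].
  by have [i2|/h0->] := leqP 2 k; [congr (_ * mom _ _); lia|rewrite !mul0r].
rewrite !h0 ?mul0r ?subrr; [|lia|lia].
have [ik|] := eqVneq i k; first by rewrite ik subrr !mul0r.
move=> ik; have -> : (i + k = 1)%N by lia.
by rewrite mom_1 ?mulr0.
Qed.

(** Here the difference of coefficients factors as 2(j - l)(2(j + l) - 1 + 2 k2), and the last
    factor is the one in the second recurrence. *)
Lemma selfadj_j (I j l : nat) :
  2 * j%:R * (2 * j%:R - 1 + 2 * k2) * mom I (j.-1 + l) - 2 * l%:R * (2 * l%:R - 1 + 2 * k2) * mom I (j + l.-1) =
  2 * (j%:R - l%:R) * E I (j + l) * mom I (j + l).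
Proof.
have key (A : R) : (1 <= j + l)%N -> mom I (j + l).-1 = A -> 
   (2 * j%:R * (2 * j%:R - 1 + 2 * k2) - 2 * l%:R * (2 * l%:R - 1 + 2 * k2)) * A = 2 * (j%:R - l%:R) * E I (j + l) * mom I (j + l).
  move=> jl1 <-; have := mom_rec2 a_ge0 lt_ab c_ge0 k2_gt k3_gt I (j + l).-1.
  have -> : ((j + l).-1.+1 = j + l)%N by lia.
  have hN : j%:R + l%:R = (j + l).-1%:R + 1 :> R by rewrite natr1 prednK// natrD.
  have -> : (j + l).-1%:R = j%:R + l%:R - 1 :> R by rewrite hN; ring.
  move=> h.
  have -> : 2 * j%:R * (2 * j%:R - 1 + 2 * k2) - 2 * l%:R * (2 * l%:R - 1 + 2 * k2) =
    2 * (j%:R - l%:R) * (2 * (j%:R + l%:R - 1) + 1 + 2 * k2) :> R by ring.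
  rewrite -mulrA h /E natrD; ring.
have [jl1|jl1] := leqP 1 (j + l).
  rewrite -(key _ jl1 erefl) mulrBl; congr (_ - _).
    by case: j {key jl1} => [|j]; [rewrite !(mulr0, mul0r)|congr (_ * mom _ _); lia].
  by case: l {key jl1} => [|l]; [rewrite !(mulr0, mul0r)|congr (_ * mom _ _); lia].
have -> : j = 0%N by lia.
have -> : l = 0%N by lia.
by rewrite !(mulr0, mul0r, subrr).
Qed.

(** With degrees M = i + 2j and M' = k + 2l, the two defects add up to (M - M')(M + M' + 2 k2 + 2 k3
    + 2) times the joint moment, which is the difference of the two eigenvalues times that
    moment. *)
Lemma selfadj_mono m m' : momseq (mul_seq (op_mono m) [:: m']) = momseq (mul_seq [:: m] (op_mono m')).
Proof.
case: m m' => [[d i] j] [[d' k] l].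
rewrite /momseq /mul_seq /= !big_cons !big_nil /= !addr0.
have h1 := selfadj_i i k (j + l); have h2 := selfadj_j (i + k) j l.
apply/eqP; rewrite -subr_eq0.
set A1 := mom (i.-2 + k) _ in h1 *; set A2 := mom (i + k.-2) _ in h1 *.
set B1 := mom _ (j.-1 + l) in h2 *; set B2 := mom _ (j + l.-1) in h2 *.
set X := mom (i + k) (j + l) in h1 h2 *.
apply/eqP; rewrite [LHS](_ : _ = d * d' * ((i%:R * (i%:R - 1) * A1 - k%:R * (k%:R - 1) * A2) +
  (2 * j%:R * (2 * j%:R - 1 + 2 * k2) * B1 - 2 * l%:R * (2 * l%:R - 1 + 2 * k2) * B2) -
  (eigenval (i + 2 * j) - eigenval (k + 2 * l)) * X)); last by ring.
rewrite h1 h2 /E /eigenval !(natrM, natrD); ring.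
Qed.

Lemma momseq_cat s t : momseq (s ++ t) = momseq s + momseq t.
Proof. by rewrite /momseq big_cat. Qed.

Lemma selfadj s t : momseq (mul_seq (op_seq s) t) = momseq (mul_seq s (op_seq t)).
Proof.
have mulE s1 t1 : momseq (mul_seq s1 t1) = \sum_(m <- s1) \sum_(m' <- t1) momseq (mul_seq [:: m] [:: m']).
  rewrite /momseq /mul_seq big_allpairs_dep /=; apply: eq_bigr => m _; apply: eq_bigr => m' _.
  by rewrite big_seq1.
have sumE (f : R * nat * nat -> R) s1 : \sum_(m <- op_seq s1) f m = \sum_(m <- s1) \sum_(m1 <- op_mono m) f m1.
  by rewrite /op_seq big_flatten big_map.
rewrite !mulE sumE; apply: eq_bigr => m _; rewrite exchange_big /= sumE; apply: eq_bigr => m' _.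
have := selfadj_mono m m'; rewrite !mulE !big_seq1 => <-.
by apply: eq_bigr => m1 _; rewrite big_seq1.
Qed.

End operator.
(** * Action of the operator on even polynomials *)

Section partial_derivatives.
Context (R : realType).
Implicit Types f g : R * R -> R.

(** The derivatives are given on the whole plane because [pd1 (pd1 f)] differentiates [pd1 f] as a
    function: its value at a point is not determined by first derivatives at that point. *)
Definition has_pd f f1 f2 f11 f12 f22 : Prop :=
  [/\ forall p : R * R, is_derive p.1 1 (fun x => f (x, p.2)) (f1 p),
      forall p : R * R, is_derive p.2 1 (fun y => f (p.1, y)) (f2 p),
      forall p : R * R, is_derive p.1 1 (fun x => f1 (x, p.2)) (f11 p),
      forall p : R * R, is_derive p.1 1 (fun x => f2 (x, p.2)) (f12 p) &
      forall p : R * R, is_derive p.2 1 (fun y => f2 (p.1, y)) (f22 p)].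

(** [frakD] with the derivatives replaced by independent numbers, in which it is visibly linear. *)
Definition frakDE (a b c k2 k3 f1 f2 f11 f12 f22 u v : R) : R :=
  let Q := - (a * b) + (a - c) * (b - c) * u ^+ 2 in
  (1 - u ^+ 2) * f11 - 2 * (v ^+ 2 - c) * (u / v) * f12
  + (a + b - v ^+ 2 + Q / v ^+ 2) * f22
  + (c - 2 * a - Q / v ^+ 2) * v^-1 * f2
  - (2 * k2 + 2 * k3 + 3) * (u * f1 + (v ^+ 2 - a) / v * f2)
  + 2 * k2 * (b - a) * v^-1 * f2.

Lemma pd1_eq f f1 : (forall p : R * R, is_derive p.1 1 (fun x => f (x, p.2)) (f1 p)) -> pd1 f = f1.
Proof. by move=> h; apply/funext => p; rewrite /pd1 derive1E; have h' := h p; rewrite derive_val. Qed.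

Lemma pd2_eq f f2 : (forall p : R * R, is_derive p.2 1 (fun y => f (p.1, y)) (f2 p)) -> pd2 f = f2.
Proof. by move=> h; apply/funext => p; rewrite /pd2 derive1E; have h' := h p; rewrite derive_val. Qed.

Lemma frakD_has_pd a b c k2 k3 f f1 f2 f11 f12 f22 p : has_pd f f1 f2 f11 f12 f22 ->
  frakD a b c k2 k3 f p = frakDE a b c k2 k3 (f1 p) (f2 p) (f11 p) (f12 p) (f22 p) p.1 p.2.
Proof.
move=> [h1 h2 h11 h12 h22].
by rewrite /frakD (pd1_eq h1) (pd2_eq h2) (pd1_eq h11) (pd1_eq h12) (pd2_eq h22).
Qed.

Lemma is_derive_lin (h1 h2 : R -> R) (x d1 d2 k : R) : is_derive x 1 h1 d1 -> is_derive x 1 h2 d2 ->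
  is_derive x 1 (fun y => k * h1 y + h2 y) (k * d1 + d2).
Proof. by move=> H1 H2; exact: (is_deriveD (is_deriveZ k H1) H2). Qed.

Lemma has_pd_lin k f f1 f2 f11 f12 f22 g g1 g2 g11 g12 g22 :
  has_pd f f1 f2 f11 f12 f22 -> has_pd g g1 g2 g11 g12 g22 ->
  has_pd (fun p => k * f p + g p) (fun p => k * f1 p + g1 p) (fun p => k * f2 p + g2 p)
    (fun p => k * f11 p + g11 p) (fun p => k * f12 p + g12 p) (fun p => k * f22 p + g22 p).
Proof.
move=> [h1 h2 h3 h4 h5] [e1 e2 e3 e4 e5]; split=> p.
- exact: (@is_derive_lin (fun x => f (x, p.2)) (fun x => g (x, p.2))).
- exact: (@is_derive_lin (fun x => f (p.1, x)) (fun x => g (p.1, x))).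
- exact: (@is_derive_lin (fun x => f1 (x, p.2)) (fun x => g1 (x, p.2))).
- exact: (@is_derive_lin (fun x => f2 (x, p.2)) (fun x => g2 (x, p.2))).
- exact: (@is_derive_lin (fun x => f2 (p.1, x)) (fun x => g2 (p.1, x))).
Qed.

Lemma has_pd0 : has_pd (fun=> 0) (fun=> 0) (fun=> 0) (fun=> 0) (fun=> 0) (fun=> 0).
Proof. by split=> p; exact: is_derive_cst. Qed.

Lemma is_derive_mul (h1 h2 : R -> R) (x d1 d2 : R) : is_derive x 1 h1 d1 -> is_derive x 1 h2 d2 ->
  is_derive x 1 (fun y => h1 y * h2 y) (h1 x * d2 + h2 x * d1).
Proof. by move=> H1 H2; exact: (is_deriveM H1 H2). Qed.

(** * Partial derivatives of u^i tau^j *)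

Section monomials.
Variables (a b c : R).
Notation tau := (tau a b c).
Notation tu u := (2 * (a - c) * u / (b - a)).
Notation tv v := (2 * v / (b - a)).

Lemma is_derive_tau_1 (p : R * R) : is_derive p.1 1 (fun x => tau (x, p.2)) (tu p.1).
Proof.
have h := is_derive_exprn 2 (is_derive_id p.1 1).
have := @is_derive_lin _ _ p.1 _ _ ((a - c) / (b - a)) h (is_derive_cst ((- a + p.2 ^+ 2) / (b - a)) p.1 1).
rewrite (_ : (fun y => _ * y ^+ 2 + _) = (fun x => tau (x, p.2))); last first.
  by apply/funext => x; rewrite /tau /=; ring.
by move=> H; apply: is_derive_eq H _; rewrite expr1; ring.
Qed.

Definition mono (i j : nat) (p : R * R) : R := p.1 ^+ i * tau p ^+ j.

Lemma is_derive_mono1 i j (p : R * R) : is_derive p.1 1 (fun x => mono i j (x, p.2))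
  (i%:R * mono i.-1 j p + j%:R * (tu p.1) * mono i j.-1 p).
Proof.
have h1 := is_derive_exprn i (is_derive_id p.1 1).
have h2 := is_derive_exprn j (is_derive_tau_1 p).
apply: is_derive_eq (is_derive_mul h1 h2) _.
by rewrite /mono /= -(surjective_pairing p); ring.
Qed.

Lemma is_derive_mono2 i j (p : R * R) : is_derive p.2 1 (fun y => mono i j (p.1, y))
  (j%:R * (tv p.2) * mono i j.-1 p).
Proof.
have h1 := is_derive_cst (p.1 ^+ i) p.2 1.
have h2 := is_derive_exprn j (is_derive_tau2 a b c p.1 p.2).
apply: is_derive_eq (is_derive_mul h1 h2) _.
by rewrite /mono /= -(surjective_pairing p); ring.
Qed.

Lemma has_pd_mono i j : has_pd (mono i j)
  (fun p => i%:R * mono i.-1 j p + j%:R * tu p.1 * mono i j.-1 p)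
  (fun p => j%:R * tv p.2 * mono i j.-1 p)
  (fun p => i%:R * (i.-1%:R * mono i.-2 j p + j%:R * tu p.1 * mono i.-1 j.-1 p)
     + j%:R * (tu 1 * mono i j.-1 p + tu p.1 * (i%:R * mono i.-1 j.-1 p + j.-1%:R * tu p.1 * mono i j.-2 p)))
  (fun p => j%:R * tv p.2 * (i%:R * mono i.-1 j.-1 p + j.-1%:R * tu p.1 * mono i j.-2 p))
  (fun p => j%:R * (tv 1 * mono i j.-1 p + tv p.2 * (j.-1%:R * tv p.2 * mono i j.-2 p))).
Proof.
split=> p.
- exact: is_derive_mono1.
- exact: is_derive_mono2.
- have hl : is_derive p.1 1 (fun x => j%:R * tu x) (j%:R * tu 1).
    have := @is_derive_lin _ _ p.1 _ _ (j%:R * (2 * (a - c) / (b - a))) (is_derive_id p.1 1) (is_derive_cst 0 p.1 1).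
    rewrite (_ : (fun y => _ * id y + _) = (fun x => j%:R * tu x)); last by apply/funext => x /=; ring.
    by move=> H; apply: is_derive_eq H _; ring.
  have H := is_derive_lin i%:R (is_derive_mono1 i.-1 j p) (is_derive_mul hl (is_derive_mono1 i j.-1 p)).
  by apply: is_derive_eq H _; rewrite -(surjective_pairing p); ring.
- have := @is_derive_lin _ _ p.1 _ _ (j%:R * tv p.2) (is_derive_mono1 i j.-1 p) (is_derive_cst 0 p.1 1).
  rewrite (_ : (fun y => _ * mono _ _ _ + _) = (fun x => j%:R * tv p.2 * mono i j.-1 (x, p.2))); last by apply/funext => x /=; rewrite addr0.
  by move=> H; apply: is_derive_eq H _; ring.
- have hl : is_derive p.2 1 (fun x => j%:R * tv x) (j%:R * tv 1).
    have := @is_derive_lin _ _ p.2 _ _ (j%:R * (2 / (b - a))) (is_derive_id p.2 1) (is_derive_cst 0 p.2 1).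
    rewrite (_ : (fun y => _ * id y + _) = (fun x => j%:R * tv x)); last by apply/funext => x /=; ring.
    by move=> H; apply: is_derive_eq H _; ring.
  have H := is_derive_mul hl (is_derive_mono2 i j.-1 p).
  by apply: is_derive_eq H _; rewrite -(surjective_pairing p); ring.
Qed.

End monomials.
End partial_derivatives.

Section frakD_even.
Context (R : realType) (a b c k2 k3 : R).
Hypothesis lt_ab : a < b.
Notation tau := (tau a b c).

Lemma frakD_mono i j (p : R * R) : p.2 != 0 ->
  frakD a b c k2 k3 (mono a b c i j) p = evalseq fst tau (op_mono k2 k3 (1, i, j)) p.
Proof.
move=> v0; rewrite (frakD_has_pd a b c k2 k3 p (has_pd_mono a b c i j)) /frakDE.
have ba : b - a != 0 by rewrite subr_eq0 gt_eqF.
rewrite /op_mono !ev_cons /evalseq big_nil /= /mono /eigenval.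
(* Separating exponents 0, 1 and at least 2 resolves the truncated predecessors. The remaining
   powers become atoms before [tau] is unfolded, which leaves a rational identity of low degree. *)
case: i => [|[|i]] /=; case: j => [|[|j]] /=; rewrite ?expr0 ?expr1 ?mul0r ?mulr0 ?muln0 ?addn0 ?add0r ?addr0;
  rewrite ?(exprS _ i.+1) ?(exprS _ j.+1) ?(exprS _ i) ?(exprS _ j).
all: try (move: (p.1 ^+ i) => P).
all: try (move: (tau p ^+ j) => T).
all: rewrite /tau; move: v0; case: p => u v /= v0.
all: try by field; rewrite ?v0 ?ba.
Qed.

(** Linearity of [frakD] requires differentiability, so the induction on the list carries witnesses
    for all the partial derivatives along with the value. *)
Lemma frakD_ev s (p : R * R) : p.2 != 0 ->
  frakD a b c k2 k3 (evalseq fst tau s) p = evalseq fst tau (op_seq k2 k3 s) p.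
Proof.
move=> v0.
have [f1 [f2 [f11 [f12 [f22 [h E]]]]]] : exists f1 f2 f11 f12 f22, has_pd (evalseq fst tau s) f1 f2 f11 f12 f22 /\
    frakDE a b c k2 k3 (f1 p) (f2 p) (f11 p) (f12 p) (f22 p) p.1 p.2 = evalseq fst tau (op_seq k2 k3 s) p.
  elim: s => [|[[d i] j] s [f1 [f2 [f11 [f12 [f22 [h E]]]]]]].
    have -> : evalseq fst tau [::] = (fun=> 0) by apply/funext => q; rewrite /evalseq big_nil.
    do 5 eexists; split; first exact: has_pd0.
    by rewrite /frakDE /=; ring.
  have hm := has_pd_mono a b c i j.
  have -> : evalseq fst tau ((d, i, j) :: s) = (fun q => d * mono a b c i j q + evalseq fst tau s q).
    by apply/funext => q; rewrite ev_cons /mono mulrA.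
  do 5 eexists; split; first exact: (has_pd_lin d hm h).
  have := frakD_mono i j v0; rewrite (frakD_has_pd a b c k2 k3 p hm) => Em.
  rewrite /op_seq /= -/(op_seq k2 k3 s) -[_ :: _]/(op_mono k2 k3 (d, i, j) ++ op_seq k2 k3 s) ev_cat -E.
  have -> : evalseq fst tau (op_mono k2 k3 (d, i, j)) p = d * evalseq fst tau (op_mono k2 k3 (1, i, j)) p.
    by rewrite /op_mono !ev_cons /evalseq !big_nil /=; ring.
  rewrite -Em /frakDE; ring.
by rewrite (frakD_has_pd a b c k2 k3 p h).
Qed.

End frakD_even.
(** * Positivity and the eigenvalue equation *)

Section eigenfunctions.
Context (R : realType) (a b c k2 k3 : R).
Hypotheses (a_ge0 : 0 <= a) (lt_ab : a < b) (c_ge0 : 0 <= c).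
Hypotheses (k2_gt : - 2^-1 < k2) (k3_gt : -1 < k3).
Notation tau := (tau a b c).
Notation W := (weight a b c k2 k3).
Notation Om := (Omega a b c).
Notation ev := (evalseq fst tau).
Notation mu2 := ((@lebesgue_measure R) \x (@lebesgue_measure R))%E.
Notation RR := (measurableTypeR R * measurableTypeR R)%type.
Notation cotau p := (1 - p.1 ^+ 2 - tau p).

Lemma continuous_tau : continuous (tau : R * R -> R).
Proof.
move=> p; have c1 : {for p, continuous (fun q : R * R => q.1)} by exact: cvg_fst.
have c2 : {for p, continuous (fun q : R * R => q.2)} by exact: cvg_snd.
apply: cvgM; last exact: cvg_cst.
apply: cvgD; last by apply: cvgM.
by apply: cvgD; [exact: cvg_cst|apply: cvgM; [exact: cvg_cst|apply: cvgM]].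
Qed.

Lemma continuous_cotau : continuous (fun p : R * R => cotau p : R).
Proof.
move=> p; have c1 : {for p, continuous (fun q : R * R => q.1)} by exact: cvg_fst.
by apply: cvgB; [apply: cvgB; [exact: cvg_cst|apply: cvgM]|exact: continuous_tau].
Qed.

Lemma continuous_ev (X Y : R * R -> R) s : continuous X -> continuous Y -> continuous (evalseq X Y s).
Proof.
move=> cX cY p; elim: s => [|m s IH].
  by rewrite (_ : evalseq X Y [::] = fun=> 0); [exact: cvg_cst|apply/funext => q; rewrite /evalseq big_nil].
rewrite (_ : evalseq X Y (m :: s) = fun q => m.1.1 * X q ^+ m.1.2 * Y q ^+ m.2 + evalseq X Y s q); last first.
  by apply/funext => q; rewrite ev_cons.
apply: cvgD => //; apply: cvgM; first apply: cvgM; first exact: cvg_cst.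
- by apply: (@continuous_comp _ _ _ X (fun x => x ^+ _)); [exact: cX|exact: exprn_continuous].
- by apply: (@continuous_comp _ _ _ Y (fun x => x ^+ _)); [exact: cY|exact: exprn_continuous].
Qed.

Lemma weight_gt0 p : p.2 != 0 -> 0 < tau p -> 0 < cotau p -> 0 < W p.
Proof. by move=> v0 t0 t1; rewrite weightE// !mulr_gt0 ?normr_gt0 ?powR_gt0. Qed.

Lemma tau_cotau_Omega p : 0 <= tau p -> 0 <= cotau p -> Om p.
Proof.
move=> t0 t1; apply/OmegaE => //; split => //.
by rewrite -(@expr_le1 _ 2)// real_normK ?num_real//; lra.
Qed.

Lemma measurable_ev s : measurable_fun [set: RR] (ev s : RR -> R).
Proof.
elim: s => [|m s IH].
  by rewrite (_ : ev [::] = fun=> 0); [exact: measurable_cst|apply/funext => q; rewrite /evalseq big_nil].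
rewrite (_ : ev (m :: s) = fun q : RR => m.1.1 * q.1 ^+ m.1.2 * tau q ^+ m.2 + ev s q); last first.
  by apply/funext => q; rewrite ev_cons.
apply: measurable_funD => //; apply: measurable_funM.
  by apply: measurable_funM => //; apply: measurable_funX; exact: measurable_fst.
apply: measurable_funX; exact: measurable_tau.
Qed.

(** If [ev s p] were nonzero, the integrand would be positive on a whole open square around [p],
    which has positive area, whereas a nonnegative function with zero integral vanishes almost
    everywhere. *)
Lemma sqr_integral0_interior s p : momseq a b c k2 k3 (mul_seq s s) = 0 ->
  0 < p.2 -> 0 < tau p -> 0 < cotau p -> ev s p = 0.
Proof.
move=> s0 v0 t0 t1; apply/eqP; apply: contraT => evp0; exfalso.
have : \forall q \near p, [/\ 0 < q.2, 0 < tau q, 0 < cotau q & ev s q != 0].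
  near=> q; split; near: q.
  - by apply: (cvgr_gt (p.2)) => //; exact: cvg_snd.
  - by apply: (cvgr_gt (tau p)) => //; exact: continuous_tau.
  - by apply: (cvgr_gt (cotau p)) => //; exact: continuous_cotau.
  - apply: (cvgr_neq0 (ev s p)) => //; apply: continuous_ev; last exact: continuous_tau.
    by move=> q; exact: cvg_fst.
move=> /nbhs_ballP[e /= e0 He].
pose f (q : RR) : \bar R := (ev s q * ev s q * W q)%:E.
have mO := measurable_Omega c lt_ab.
have f0 q : (0 <= f q)%E by rewrite lee_fin mulr_ge0 ?weight_ge0// -expr2 sqr_ge0.
have mf : measurable_fun (Om : set RR) f.
  apply: measurable_funTS; apply/measurable_EFinP; apply: measurable_funM; last exact: measurable_weight.
  by apply: measurable_funM; exact: measurable_ev.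
have fI : (\int[mu2]_(q in Om) `|f q| = 0)%E.
  have := Rintegral_ev a_ge0 lt_ab c_ge0 k2_gt k3_gt (mul_seq s s); rewrite s0.
  have := integrable_ev a_ge0 lt_ab c_ge0 k2_gt k3_gt (mul_seq s s) => hi.
  have hf : (\int[mu2]_(x in Om) (ev (mul_seq s s) x * W x)%:E)%E \is a fin_num by exact: (integrable_fin_num mO hi).
  rewrite /Rintegral => hE.
  transitivity (\int[mu2]_(x in Om) (ev (mul_seq s s) x * W x)%:E)%E.
    by apply: eq_integral => q _; rewrite gee0_abs// /f ev_mul.
  by rewrite -(fineK hf) hE.
have /(ae_eq_integral_abs _ mO mf) [N [mN N0 sub]] := fI.
pose B : set RR := `](p.1 - e), (p.1 + e)[%classic `*` `](p.2 - e), (p.2 + e)[%classic.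
have mB : measurable B by apply: measurableX.
have BN : B `<=` N.
  move=> q [/= q1 q2]; apply: sub => /= h.
  have /He[q20 tq cq evq] : ball p e q.
    split; rewrite /ball /= ltr_distlC; [move: q1|move: q2]; rewrite in_itv/= => /andP[? ?]; apply/andP; split; lra.
  have /h : Om q by apply: tau_cotau_Omega; exact: ltW.
  have Wq : 0 < W q by apply: weight_gt0 => //; rewrite gt_eqF.
  have W0 : W q != 0 by rewrite gt_eqF.
  have fq : ev s q * ev s q * W q != 0 by rewrite mulf_neq0// mulf_neq0.
  rewrite /f => -[] E; move: fq; rewrite E eqxx; exact: notF.
have : (mu2 B <= mu2 N)%E by apply: le_measure; rewrite ?inE.
rewrite N0 product_measure1E//= !lebesgue_measure_itv/= !lte_fin.
have h1 (x : R) : x - e < x + e by lra.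
rewrite !h1 -!EFinB -EFinM lee_fin leNgt => /negP; apply.
by apply: mulr_gt0; lra.
Unshelve. all: end_near. Qed.

(* In the coordinates (u, tau) the region is convex, so a boundary point is
   reached along a segment issuing from the interior point (0, 1/2). *)
Lemma sqr_integral0 s p : momseq a b c k2 k3 (mul_seq s s) = 0 -> Om p -> ev s p = 0.
Proof.
move=> s0 pO; have [_ t0 t1] := (OmegaE c lt_ab p).1 pO.
apply/eqP; apply: contraT => evp0; exfalso.
pose X (l : R) := l * p.1; pose Y (l : R) := (1 - l) / 2 + l * tau p.
pose g (l : R) := \sum_(m <- s) m.1.1 * X l ^+ m.1.2 * Y l ^+ m.2.
have cX : continuous X by move=> l; apply: cvgM; [exact: cvg_id|exact: cvg_cst].
have cY : continuous Y.
  move=> l; apply: cvgD; apply: cvgM; [|exact: cvg_cst|exact: cvg_id|exact: cvg_cst].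
  by apply: cvgB; [exact: cvg_cst|exact: cvg_id].
have cg : continuous g.
  rewrite /g; elim: s {s0 evp0 g} => [|m s IH] l.
    by under eq_fun do rewrite big_nil; exact: cvg_cst.
  under eq_fun do rewrite big_cons.
  apply: cvgD; last exact: IH.
  apply: cvgM; first (apply: cvgM; first exact: cvg_cst).
  - by apply: (@continuous_comp _ _ _ X (fun x => x ^+ _)); [exact: cX|exact: exprn_continuous].
  - by apply: (@continuous_comp _ _ _ Y (fun x => x ^+ _)); [exact: cY|exact: exprn_continuous].
have g1 : g 1 != 0.
  rewrite (_ : g 1 = ev s p)// /g /evalseq; apply: eq_bigr => m _.
  by rewrite /X /Y mul1r subrr mul0r add0r mul1r.
have [l [l0 l1 gl]] : exists l, [/\ 0 < l, l < 1 & g l != 0].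
  near (1 : R)^'- => l; exists l; split; near: l.
  - by apply: nbhs_left_gt; exact: ltr01.
  - exact: nbhs_left_lt.
  - by apply: (cvgr_neq0 (g 1)) => //; apply: cvg_at_left_filter; exact: cg.
have sq0 := sqr_ge0 p.1.
have Y0 : 0 < Y l by rewrite /Y; nra.
(* With p = (u, v), this is l (1 - u^2 - tau) + l (1 - l) u^2 + (1 - l)/2, whose last term is
   positive. *)
have Y1 : 0 < 1 - X l ^+ 2 - Y l by rewrite /X /Y exprMn; nra.
have Xin : X l \in `](-1), 1[.
  have : X l ^+ 2 < 1 by lra.
  by rewrite in_itv/=; move: (X l) => x x2; apply/andP; split; nra.
have al0 := al_ge0 a_ge0 c_ge0 Xin.
(* The point of the upper half plane whose coordinates (u, tau) are [X l] and [Y l]. As [ev s] sees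
   only these coordinates, the sign of the second component of [p] does not matter. *)
pose q := (X l, Num.sqrt (a + (c - a) * X l ^+ 2 + (b - a) * Y l)).
have ba : 0 < b - a by rewrite subr_gt0.
have r0 : 0 < a + (c - a) * X l ^+ 2 + (b - a) * Y l by rewrite ltr_wpDl// mulr_gt0.
have tq : tau q = Y l.
  by rewrite tau_section sqr_sqrtr ?(ltW r0)//; field; rewrite gt_eqF.
move: gl; rewrite (_ : g l = ev s q); last by rewrite /g /evalseq tq.
rewrite (@sqr_integral0_interior s q)// ?eqxx//; rewrite ?tq//= sqrtr_gt0//.
Unshelve. all: end_near. Qed.

(** Grouping by source monomial exhibits the diagonal coefficient as a difference of eigenvalues,
    zero in degree n. *)
Lemma ev_residual n s p : ev (scale_seq (eigenval k2 k3 n) s ++ op_seq k2 k3 s) p =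
  \sum_(m <- s) (m.1.1 * (m.1.2%:R * (m.1.2%:R - 1)) * p.1 ^+ m.1.2.-2 * tau p ^+ m.2 +
    m.1.1 * (eigenval k2 k3 n - eigenval k2 k3 (m.1.2 + 2 * m.2)) * p.1 ^+ m.1.2 * tau p ^+ m.2 +
    m.1.1 * (2 * m.2%:R * (2 * m.2%:R - 1 + 2 * k2)) * p.1 ^+ m.1.2 * tau p ^+ m.2.-1).
Proof.
rewrite ev_cat ev_scale; elim: s => [|[[d i] j] s IH]; first by rewrite /evalseq !big_nil mulr0 addr0.
by rewrite big_cons -IH /op_seq /= !ev_cons /=; ring.
Qed.

Lemma op_seq_deg n s : all (fun m => m.1.2 + 2 * m.2 <= n)%N s -> spanned 2 fst tau n (ev (op_seq k2 k3 s)).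
Proof.
move=> hs; exists (op_seq k2 k3 s) => //; elim: s hs => [//|[[d i] j] s IH] /= /andP[h /IH IHs].
by rewrite IHs !andbT; apply/and3P; split; lia.
Qed.

(** The diagonal terms of degree n cancel and the other two terms lower the degree by two. Degree 0
    is set apart because [n.-1] would then be 0 again; there the residual vanishes identically. *)
Lemma residual_deg n s : all (fun m => m.1.2 + 2 * m.2 <= n)%N s ->
  let r := scale_seq (eigenval k2 k3 n) s ++ op_seq k2 k3 s in
  (forall p, ev r p = 0) \/ ((0 < n)%N /\ spanned 2 fst tau n.-1 (ev r)).
Proof.
move=> hs r; case: n @r hs => [|n] r hs.
  left=> p; rewrite ev_residual big_seq big1// => -[[d i] j] /(allP hs) /= h.
  have -> : i = 0%N by lia.
  have -> : j = 0%N by lia.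
  by rewrite /= muln0 addn0; ring.
right; split=> //; apply: (spanned_eq (fun p => esym (ev_residual n.+1 s p))).
move: hs; rewrite /r {r}; move: s => s' hs.
apply: (@spanned_eq _ 2 fst tau n (fun p => \sum_(m <- s' | (m.1.2 + 2 * m.2 <= n.+1)%N)
   (m.1.1 * (m.1.2%:R * (m.1.2%:R - 1)) * p.1 ^+ m.1.2.-2 * tau p ^+ m.2 +
    m.1.1 * (eigenval k2 k3 n.+1 - eigenval k2 k3 (m.1.2 + 2 * m.2)) * p.1 ^+ m.1.2 * tau p ^+ m.2 +
    m.1.1 * (2 * m.2%:R * (2 * m.2%:R - 1 + 2 * k2)) * p.1 ^+ m.1.2 * tau p ^+ m.2.-1))).
  move=> p; rewrite -big_filter; congr (\sum_(m <- _) _); exact/all_filterP.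
apply: spanned_sum => -[[d i] j] /= h.
have zero (k : R) (x y : nat) : k = 0 -> spanned 2 fst tau n (fun p => k * p.1 ^+ x * tau p ^+ y).
  by move=> ->; apply: (spanned_eq _ (spanned0 2 fst tau n)) => p; rewrite !mul0r.
apply: spannedD; first apply: spannedD.
- case: i h => [|[|i]] h; [apply: zero; ring..|by apply: spanned_mono; lia].
- have [e|ne] := eqVneq (i + 2 * j)%N n.+1; first by apply: zero; rewrite e; ring.
  by apply: spanned_mono; lia.
- case: j h => [|j] h; [apply: zero; ring|by apply: spanned_mono; lia].
Qed.

Lemma frakD_eigen (n : nat) (Y : R * R -> R) : VnE W Om n Y ->
  forall p, Om p -> p.2 != 0 ->
    frakD a b c k2 k3 Y p = - eigenval k2 k3 n * Y p.
Proof.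
move=> [pY eY oY].
have [s hs Ys] := even_poly2_spanned c lt_ab pY eY.
have {}Ys : Y = ev s by apply/funext.
(* The residual r has degree < n and is orthogonal to itself. *)
pose r := scale_seq (eigenval k2 k3 n) s ++ op_seq k2 k3 s.
suff r0 p : Om p -> ev r p = 0.
  move=> p pO v0; rewrite Ys frakD_ev//; apply/eqP; rewrite -subr_eq0 mulNr opprK addrC.
  by rewrite -ev_scale -ev_cat r0.
have rdeg := residual_deg hs.
case: rdeg => [h|[n0 hr]]; first by move=> _; exact: h.
apply: sqr_integral0.
(* As a list, [r] still contains monomials of degree n whose coefficients cancel only on evaluation;
   [r'] represents the same function with honest degrees below n. *)
have [r' hr' rr'] := hr.
have ortho t : spanned 2 fst tau n.-1 (ev t) -> momseq a b c k2 k3 (mul_seq s t) = 0.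
  move=> /spanned_even_poly ht; rewrite -Rintegral_ev// /Rintegral.
  have := oY n.-1 _ _ ht; rewrite prednK// leqnn => /(_ isT); rewrite /L2ip.
  under [X in fine X]eq_integral => q _ do rewrite ev_mul -Ys.
  by move=> ->.
have momext t1 t2 : (forall p, ev t1 p = ev t2 p) -> momseq a b c k2 k3 t1 = momseq a b c k2 k3 t2.
  move=> h; rewrite -!(Rintegral_ev a_ge0 lt_ab c_ge0 k2_gt k3_gt).
  by apply: eq_Rintegral => q _; rewrite h.
rewrite (momext _ (mul_seq r r')); last by move=> q; rewrite !ev_mul rr'.
rewrite {1}/r (momext _ (scale_seq (eigenval k2 k3 n) (mul_seq s r') ++ mul_seq (op_seq k2 k3 s) r')); last first.
  by move=> q; rewrite ev_mul !ev_cat !ev_scale !ev_mul; ring.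
(* Self-adjointness moves the operator from [s] to [r'], whose image still has degree below n, so
   orthogonality of Y kills this term; the other term is a multiple of the pairing of Y with
   [r']. *)
rewrite momseq_cat selfadj// (ortho (op_seq k2 k3 r')) ?addr0; last exact: op_seq_deg.
rewrite -Rintegral_ev//.
under eq_Rintegral => q _ do rewrite ev_scale.
rewrite (_ : (fun p => _ * _ * W p) = (fun p => eigenval k2 k3 n * (ev (mul_seq s r') p * W p))); last first.
  by apply/funext => q; rewrite mulrA.
rewrite RintegralZl//; [|exact: measurable_Omega|exact: integrable_ev].
rewrite Rintegral_ev// ortho ?mulr0//.
by apply: spanned_eq hr.
Qed.

End eigenfunctions.
(** * Chain rule and symmetry of second derivatives *)

Section two_variable_calculus.
Context (R : realType).
Implicit Types f g : R * R -> R.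

(** The mean value theorem for an increment of either sign or zero, with the intermediate point
    controlled by distance, as suits balls in the plane. *)
Lemma MVT_dist (F dF : R -> R) (x h e : R) : `|h| < e ->
  (forall s, `|x - s| < e -> is_derive s 1 F (dF s)) ->
  exists2 xi, `|x - xi| < e & F (x + h) - F x = dF xi * h.
Proof.
move=> he dFe.
have [h0|h0|->] := ltgtP h 0.
- have xh : x + h < x by lra.
  move: he; rewrite ltr_norml => /andP[he1 he2].
  have ine s : s \in `[x + h, x] -> `|x - s| < e.
    by rewrite in_itv/= ltr_norml => /andP[? ?]; apply/andP; split; lra.
  have dI (s : R) : s \in `]x + h, x[ -> is_derive s 1 F (dF s).
    by move=> /(subset_itv_oo_cc) /ine /dFe.
  have cF : {within `[x + h, x], continuous F}.
    by apply: derivable_within_continuous => s /ine /dFe ds; exact: ex_derive.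
  have [xi xiI E] := MVT xh dI cF.
  by exists xi; [exact: ine (subset_itv_oo_cc xiI)|rewrite -(opprB (F x)) E; ring].
- have xh : x < x + h by lra.
  move: he; rewrite ltr_norml => /andP[he1 he2].
  have ine s : s \in `[x, x + h] -> `|x - s| < e.
    by rewrite in_itv/= ltr_norml => /andP[? ?]; apply/andP; split; lra.
  have dI (s : R) : s \in `]x, x + h[ -> is_derive s 1 F (dF s).
    by move=> /(subset_itv_oo_cc) /ine /dFe.
  have cF : {within `[x, x + h], continuous F}.
    by apply: derivable_within_continuous => s /ine /dFe ds; exact: ex_derive.
  have [xi xiI E] := MVT xh dI cF.
  by exists xi; [exact: ine (subset_itv_oo_cc xiI)|rewrite E; ring].
- exists x; last by rewrite addr0 subrr mulr0.
  by rewrite subrr normr0 (le_lt_trans _ he).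
Qed.

Definition pd1_ok g (p : R * R) : Prop := derivable (fun x => g (x, p.2)) p.1 1.
Definition pd2_ok g (p : R * R) : Prop := derivable (fun y => g (p.1, y)) p.2 1.

Lemma pd1_okP g p : pd1_ok g p -> is_derive p.1 1 (fun x => g (x, p.2)) (pd1 g p).
Proof. by move=> h; rewrite /pd1 derive1E; exact: derivableP. Qed.

Lemma pd2_okP g p : pd2_ok g p -> is_derive p.2 1 (fun y => g (p.1, y)) (pd2 g p).
Proof. by move=> h; rewrite /pd2 derive1E; exact: derivableP. Qed.

Lemma ball_pairE (p q : R * R) e : ball p e q <-> `|p.1 - q.1| < e /\ `|p.2 - q.2| < e.
Proof. by []. Qed.

(** Continuity of one partial derivative, together with existence of the other at the point, takes
    the place of total differentiability. *)
Lemma chain1 g (phi : R -> R) (x dphi : R) :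
  (\forall q \near (x, phi x), pd1_ok g q) ->
  {for (x, phi x), continuous (pd1 g)} ->
  pd2_ok g (x, phi x) -> is_derive x 1 phi dphi ->
  is_derive x 1 (fun s => g (s, phi s)) (pd1 g (x, phi x) + pd2 g (x, phi x) * dphi).
Proof.
move=> ok1 c1 ok2 dphi'.
(* g (s, phi s) = A s + g (x, phi s), and the mean value theorem in the first
   variable gives A'(x) = pd1 g (x, phi x). *)
have dB : is_derive x 1 (fun s => g (x, phi s)) (pd2 g (x, phi x) * dphi).
  exact: (is_derive1_comp (pd2_okP ok2) dphi').
pose A s := g (s, phi s) - g (x, phi s).
have dA : is_derive x 1 A (pd1 g (x, phi x)).
  have cvA : h^-1 *: ((A \o shift x) (h *: 1) - A x) @[h --> 0^'] --> pd1 g (x, phi x).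
    apply/cvgrPdist_lt => eps eps0.
    have /cvgrPdist_lt /(_ _ eps0) c1e := c1.
    have /nbhs_ballP[e /= e0 He] : \forall q \near (x, phi x),
        pd1_ok g q /\ `|pd1 g (x, phi x) - pd1 g q| < eps.
      exact: (filterS2 _ (fun q h1 h2 => conj h1 h2) ok1 c1e).
    have cphi : {for x, continuous phi} := is_derive_continuous dphi'.
    have hphi : \forall h \near (0 : R)^', `|phi x - phi (h + x)| < e.
      have : phi (h + x) @[h --> (0 : R)^'] --> phi x.
        have hx : h + x @[h --> (0 : R)^'] --> 0 + x.
          by apply: cvg_within_filter; apply: cvgD; [exact: cvg_id|exact: cvg_cst].
        rewrite add0r in hx; exact: (cvg_comp _ _ hx cphi).
      by move=> /cvgrPdist_lt; exact.
    near=> h.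
    have h0 : h != 0 by near: h; exact: nbhs_dnbhs_neq.
    have he : `|h| < e by near: h; apply: dnbhs0_lt.
    have hp : `|phi x - phi (h + x)| < e by near: h.
    have dI s : `|x - s| < e -> is_derive s 1 (fun s => g (s, phi (h + x))) (pd1 g (s, phi (h + x))).
      by move=> xs; have [ok _] := He (s, phi (h + x)) (conj xs hp); exact: (pd1_okP ok).
    have [xi xie E] := MVT_dist he dI.
    rewrite /A /= subrr subr0 /GRing.scale/= mulr1.
    rewrite (addrC x h) in E; rewrite E mulrC mulfK//.
    by have [_ ] := He (xi, phi (h + x)) (conj xie hp).
  split; first by apply/cvg_ex; exists (pd1 g (x, phi x)).
  exact: cvg_lim.
have -> : (fun s => g (s, phi s)) = (fun s => A s + g (x, phi s)).
  by apply/funext => s; rewrite /A subrK.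
exact: is_deriveD.
Unshelve. all: end_near. Qed.

Lemma ltr_dist_double (u1 u2 u3 e : R) : `|u1 - u3| < e -> `|u2 - u3| < e -> `|u1 - u2| < e + e.
Proof. by move=> l1 l2; rewrite (le_lt_trans (ler_distD u3 _ _))// ltrD// distrC. Qed.

(** The second difference of [f] over a small square, evaluated by the mean value theorem in either
    order, equals h^2 times each mixed derivative at some nearby point. *)
Lemma schwarz f (p : R * R) :
  (\forall q \near p, [/\ pd1_ok f q, pd2_ok f q, pd2_ok (pd1 f) q & pd1_ok (pd2 f) q]) ->
  {for p, continuous (pd2 (pd1 f))} -> {for p, continuous (pd1 (pd2 f))} ->
  pd2 (pd1 f) p = pd1 (pd2 f) p.
Proof.
case: p => x y ok c21 c12; apply/eqP; apply: contraT => ne; exfalso.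
pose eps := `|pd2 (pd1 f) (x, y) - pd1 (pd2 f) (x, y)| / 2.
(* Half the supposed gap: two values closer than this to a common number cannot be that far
   apart. *)
have eps0 : 0 < eps by rewrite divr_gt0// normr_gt0 subr_eq0.
have /cvgrPdist_lt /(_ _ eps0) c21e := c21.
have /cvgrPdist_lt /(_ _ eps0) c12e := c12.
have /nbhs_ballP[e /= e0 He] : \forall q \near (x, y),
    [/\ pd1_ok f q, pd2_ok f q, pd2_ok (pd1 f) q & pd1_ok (pd2 f) q] /\
    (`|pd2 (pd1 f) (x, y) - pd2 (pd1 f) q| < eps /\ `|pd1 (pd2 f) (x, y) - pd1 (pd2 f) q| < eps).
  exact: (filterS3 _ (fun q h1 h2 h3 => conj h1 (conj h2 h3)) ok c21e c12e).
pose h := e / 2; have h0 : 0 < h by rewrite divr_gt0.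
have he : `|h| < e by rewrite gtr0_norm// /h; lra.
have e00 (z : R) : `|z - z| < e by rewrite subrr normr0.
have eh (z : R) : `|z - (z + h)| < e by rewrite opprD addrA subrr add0r normrN.
pose D := f (x + h, y + h) - f (x + h, y) - f (x, y + h) + f (x, y).
have [q1 q1e D1] : exists2 q, ball (x, y) e q & D = pd2 (pd1 f) q * h * h.
  have dI s : `|x - s| < e -> is_derive s 1 (fun s => f (s, y + h) - f (s, y)) (pd1 f (s, y + h) - pd1 f (s, y)).
    move=> xs; have [[ok1 _ _ _] _] := He (s, y + h) (conj xs (eh y)).
    have [[ok1' _ _ _] _] := He (s, y) (conj xs (e00 y)).
    exact: (is_deriveB (pd1_okP ok1) (pd1_okP ok1')).
  have [xi xie E1] := MVT_dist he dI.
  have dJ s : `|y - s| < e -> is_derive s 1 (fun s => pd1 f (xi, s)) (pd2 (pd1 f) (xi, s)).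
    by move=> ys; have [[_ _ ok3 _] _] := He (xi, s) (conj xie ys); exact: (pd2_okP ok3).
  have [eta etae E2] := MVT_dist he dJ.
  exists (xi, eta); first exact: (conj xie etae).
  by rewrite -E2 -E1 /D; ring.
have [q2 q2e D2] : exists2 q, ball (x, y) e q & D = pd1 (pd2 f) q * h * h.
  have dI s : `|y - s| < e -> is_derive s 1 (fun s => f (x + h, s) - f (x, s)) (pd2 f (x + h, s) - pd2 f (x, s)).
    move=> ys; have [[_ ok1 _ _] _] := He (x + h, s) (conj (eh x) ys).
    have [[_ ok1' _ _] _] := He (x, s) (conj (e00 x) ys).
    exact: (is_deriveB (pd2_okP ok1) (pd2_okP ok1')).
  have [eta etae E1] := MVT_dist he dI.
  have dJ s : `|x - s| < e -> is_derive s 1 (fun s => pd2 f (s, eta)) (pd1 (pd2 f) (s, eta)).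
    by move=> xs; have [[_ _ _ ok4] _] := He (s, eta) (conj xs etae); exact: (pd1_okP ok4).
  have [xi xie E2] := MVT_dist he dJ.
  exists (xi, eta); first exact: (conj xie etae).
  by rewrite -E2 -E1 /D; ring.
have cancel_h (u1 u2 : R) : D = u1 * h * h -> D = u2 * h * h -> u1 = u2.
  by move=> -> /(mulIf (lt0r_neq0 h0))/(mulIf (lt0r_neq0 h0)).
have E := cancel_h _ _ D1 D2.
have [_ [A1 _]] := He _ q1e; have [_ [_ A2]] := He _ q2e.
rewrite -E in A2; have := ltr_dist_double A1 A2.
by rewrite /eps -splitr ltxx.
Unshelve. all: end_near. Qed.

End two_variable_calculus.

(** * The change of variables [psi] *)

Section pullback.
Context (R : realType) (a b c k2 k3 : R).
Hypothesis (lt_ab : a < b).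
Notation tau := (tau a b c).
Notation cotau p := (1 - p.1 ^+ 2 - tau p).
Notation tt := (tt a b c).
Notation psi := (psi a b c).
Notation UHD := (interior (@upper_half_disk R)).

(** Open conditions that replace the interior of [Lambda]: there v is nonzero, the square root in
    [tt] is smooth, and [psi] lands in the interior of the half disk. *)
Definition inside (p : R * R) : Prop := [/\ 0 < p.2, 0 < tau p & 0 < cotau p].

Lemma near_inside p : inside p -> \forall q \near p, inside q.
Proof.
move=> [v0 t0 t1].
near=> q; split; near: q.
- by apply: (cvgr_gt (p.2)) => //; exact: cvg_snd.
- by apply: (cvgr_gt (tau p)) => //; exact: continuous_tau.
- by apply: (cvgr_gt (cotau p)) => //; exact: continuous_cotau.
Unshelve. all: end_near. Qed.

(** For v > 0, tau increases strictly with v. Moving v down by e/2 inside [Lambda] makes v and tau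
    strictly positive at [p], moving it up makes 1 - u^2 - tau strictly positive. *)
Lemma interior_Lambda_inside p : interior (Lambda a b c) p -> inside p.
Proof.
move=> /nbhs_ballP[e /= e0 He].
have He2 s : `|s| < e -> Lambda a b c (p.1, p.2 + s).
  move=> se; apply: He; apply/ball_pairE; split=> /=; first by rewrite subrr normr0.
  by rewrite opprD addrA subrr add0r normrN.
have e2 : `|e / 2| < e by rewrite gtr0_norm ?divr_gt0//; lra.
have e2' : `|- (e / 2)| < e by rewrite normrN.
have [/(OmegaE c lt_ab)[_ _ h1] v1] := He2 _ e2.
have [/(OmegaE c lt_ab)[_ h2 _] v2] := He2 _ e2'.
have ba : 0 < b - a by rewrite subr_gt0.
move: h1 h2 v1 v2; rewrite /= !tau_section /inside (surjective_pairing p) tau_section /= => h1 h2 v1 v2.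
have d (x : R) : (x - (a + (c - a) * p.1 ^+ 2)) / (b - a) * (b - a) = x - (a + (c - a) * p.1 ^+ 2).
  by rewrite divfK// gt_eqF.
split; first by lra.
- apply: (le_lt_trans h2); rewrite ltr_pM2r ?invr_gt0// ltrD2r; nra.
- apply: (le_lt_trans h1); rewrite ltrD2l ltrN2 ltr_pM2r ?invr_gt0// ltrD2r; nra.
Qed.

Lemma psi_UHD p : inside p -> UHD (psi p).
Proof.
move=> [v0 t0 t1]; rewrite /interior /=.
have h1 : 0 < (psi p).2 by rewrite /psi /tt sqrtr_gt0.
have h2 : (psi p).1 ^+ 2 + (psi p).2 ^+ 2 < 1.
  by rewrite /psi /tt /= sqr_sqrtr ?(ltW t0)//; move: t1; rewrite /tau => t1; lra.
move: (psi p) h1 h2 => r h1 h2.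
have : \forall q \near r, 0 < q.2 /\ q.1 ^+ 2 + q.2 ^+ 2 < 1.
  near=> q; split; near: q.
  - by apply: (cvgr_gt (r.2)) => //; exact: cvg_snd.
  - apply: (cvgr_lt (r.1 ^+ 2 + r.2 ^+ 2)) => //.
    have c1 : {for r, continuous (fun q : R * R => q.1)} by exact: cvg_fst.
    have c2 : {for r, continuous (fun q : R * R => q.2)} by exact: cvg_snd.
    by apply: cvgD; apply: cvgM.
by apply: filterS => q [? ?]; split; exact: ltW.
Unshelve. all: end_near. Qed.

(** The partial derivatives of [tt], from implicit differentiation of (b - a) t^2 = -a + (a - c) u^2
    + v^2. *)
Definition ttu (p : R * R) : R := (a - c) * p.1 / ((b - a) * tt p).
Definition ttv (p : R * R) : R := p.2 / ((b - a) * tt p).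

Lemma ttE p : tt p = Num.sqrt (tau p). Proof. by []. Qed.

Lemma tt_gt0 p : inside p -> 0 < tt p.
Proof. by move=> [_ t0 _]; rewrite ttE sqrtr_gt0. Qed.

Lemma is_derive_tt1 p : inside p -> is_derive p.1 1 (fun x => tt (x, p.2)) (ttu p).
Proof.
move=> ip; have t0 := tt_gt0 ip; have [_ tau0 _] := ip.
have h := is_derive_tau_1 a b c p.
have tau0' : 0 < tau (p.1, p.2) by rewrite -(surjective_pairing p).
have H := @is_derive_sqrt R (fun x => tau (x, p.2)) p.1 _ tau0' h; rewrite /= -(surjective_pairing p) -ttE in H.
apply: is_derive_eq H _; rewrite /ttu; field.
by rewrite (gt_eqF t0) subr_eq0 (gt_eqF lt_ab).
Qed.

Lemma is_derive_tt2 p : inside p -> is_derive p.2 1 (fun y => tt (p.1, y)) (ttv p).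
Proof.
move=> ip; have t0 := tt_gt0 ip; have [_ tau0 _] := ip.
have h := is_derive_tau2 a b c p.1 p.2.
have tau0' : 0 < tau (p.1, p.2) by rewrite -(surjective_pairing p).
have H := @is_derive_sqrt R (fun y => tau (p.1, y)) p.2 _ tau0' h; rewrite /= -(surjective_pairing p) -ttE in H.
apply: is_derive_eq H _; rewrite /ttv; field.
by rewrite (gt_eqF t0) subr_eq0 (gt_eqF lt_ab).
Qed.

Lemma is_derive_quot (h1 h2 : R -> R) (x d1 d2 : R) : is_derive x 1 h1 d1 ->
  is_derive x 1 h2 d2 -> h2 x != 0 -> is_derive x 1 (fun y => h1 y / h2 y) ((d1 * h2 x - h1 x * d2) / h2 x ^+ 2).
Proof.
move=> H1 H2 n0; have H3 := is_deriveV n0 H2.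
apply: is_derive_eq (is_derive_mul H1 H3) _; rewrite /GRing.scale/=; field.
exact: n0.
Qed.

Lemma is_derive_Zl (h1 : R -> R) (x d1 k : R) : is_derive x 1 h1 d1 -> is_derive x 1 (fun y => k * h1 y) (k * d1).
Proof. by move=> H1; exact: (is_deriveZ k H1). Qed.

Lemma is_derive_ttu1 p : inside p ->
  is_derive p.1 1 (fun x => ttu (x, p.2)) ((a - c) / ((b - a) * tt p) * (1 - p.1 * ttu p / tt p)).
Proof.
move=> ip; have t0 := tt_gt0 ip; have ba : b - a != 0 by rewrite subr_eq0 gt_eqF.
have n0 : (b - a) * tt (p.1, p.2) != 0.
  by rewrite -(surjective_pairing p) mulf_neq0// gt_eqF.
have H := is_derive_quot (is_derive_Zl (a - c) (is_derive_id p.1 1)) (is_derive_Zl (b - a) (is_derive_tt1 ip)) n0.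
apply: is_derive_eq H _; rewrite /= -(surjective_pairing p); field.
by rewrite ba gt_eqF.
Qed.

Lemma is_derive_ttv1 p : inside p ->
  is_derive p.1 1 (fun x => ttv (x, p.2)) (- (p.2 * ttu p) / ((b - a) * tt p ^+ 2)).
Proof.
move=> ip; have t0 := tt_gt0 ip; have ba : b - a != 0 by rewrite subr_eq0 gt_eqF.
have n0 : (b - a) * tt (p.1, p.2) != 0.
  by rewrite -(surjective_pairing p) mulf_neq0// gt_eqF.
have H := is_derive_quot (is_derive_cst p.2 p.1 1) (is_derive_Zl (b - a) (is_derive_tt1 ip)) n0.
apply: is_derive_eq H _; rewrite /= -(surjective_pairing p); field.
by rewrite ba gt_eqF.
Qed.

Lemma is_derive_ttv2 p : inside p ->
  is_derive p.2 1 (fun y => ttv (p.1, y)) ((1 - p.2 * ttv p / tt p) / ((b - a) * tt p)).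
Proof.
move=> ip; have t0 := tt_gt0 ip; have ba : b - a != 0 by rewrite subr_eq0 gt_eqF.
have n0 : (b - a) * tt (p.1, p.2) != 0.
  by rewrite -(surjective_pairing p) mulf_neq0// gt_eqF.
have H := is_derive_quot (is_derive_id p.2 1) (is_derive_Zl (b - a) (is_derive_tt2 ip)) n0.
apply: is_derive_eq H _; rewrite /= -(surjective_pairing p); field.
by rewrite ba gt_eqF.
Qed.

Lemma near_slice1 (P : R * R -> Prop) (p : R * R) : (\forall q \near p, P q) -> \forall x \near p.1, P (x, p.2).
Proof.
move=> /nbhs_ballP[e /= e0 He]; apply/nbhs_ballP; exists e => //= x xe.
by apply: He; apply/ball_pairE; split=> //=; rewrite subrr normr0.
Qed.

Lemma near_slice2 (P : R * R -> Prop) (p : R * R) : (\forall q \near p, P q) -> \forall y \near p.2, P (p.1, y).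
Proof.
move=> /nbhs_ballP[e /= e0 He]; apply/nbhs_ballP; exists e => //= x xe.
by apply: He; apply/ball_pairE; split=> //=; rewrite subrr normr0.
Qed.

Lemma mem_seq7 (T : eqType) (x1 x2 x3 x4 x5 x6 x7 : T) : let s := [:: x1; x2; x3; x4; x5; x6; x7] in
  [/\ x2 \in s, x4 \in s, x5 \in s, x6 \in s & x7 \in s].
Proof. by split; rewrite !inE eqxx ?orbT. Qed.

(** * Partial derivatives of [f \o psi] *)

Section derivatives.
Variable f : R * R -> R.
Hypothesis f_C2 : C2_on UHD f.

Lemma C2_pd_ok g p : g \in [:: f; pd1 f; pd2 f] -> UHD p -> pd1_ok g p /\ pd2_ok g p.
Proof. by move=> hg /f_C2[H _]; exact: H. Qed.

Lemma C2_near_ok1 g p : g \in [:: f; pd1 f; pd2 f] -> UHD p -> \forall q \near p, pd1_ok g q.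
Proof.
move=> hg /nbhs_interior; apply: filterS => q hq.
by have [] := C2_pd_ok hg hq.
Qed.

Lemma C2_cont p : UHD p ->
  [/\ {for p, continuous (pd1 f)}, {for p, continuous (pd1 (pd1 f))}, {for p, continuous (pd1 (pd2 f))},
      {for p, continuous (pd2 (pd1 f))} & {for p, continuous (pd2 (pd2 f))}].
Proof.
move=> /f_C2[_ H].
have [i1 i3 i4 i5 i6] := mem_seq7 f (pd1 f) (pd2 f) (pd1 (pd1 f)) (pd1 (pd2 f)) (pd2 (pd1 f)) (pd2 (pd2 f)).
exact: (And5 (H _ i1) (H _ i3) (H _ i4) (H _ i5) (H _ i6)).
Qed.

(** The variable u enters both components of [psi], hence the chain rule along a graph; v enters
    only the second, where the one-variable rule suffices. *)
Lemma is_derive_comp_psi1 g p : g \in [:: f; pd1 f; pd2 f] -> inside p ->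
  is_derive p.1 1 (fun x => g (psi (x, p.2))) (pd1 g (psi p) + pd2 g (psi p) * ttu p).
Proof.
move=> hg ip; have hU := psi_UHD ip.
have E : (p.1, tt (p.1, p.2)) = psi p by [].
have := @chain1 R g (fun x => tt (x, p.2)) p.1 (ttu p).
rewrite E; apply.
- exact: C2_near_ok1.
- have [c1 c11 c12 _ _] := C2_cont hU.
  move: hg; rewrite !inE => /or3P[] /eqP ->; [exact: c1|exact: c11|exact: c12].
- by have [] := C2_pd_ok hg hU.
- exact: is_derive_tt1.
Qed.

Lemma is_derive_comp_psi2 g p : g \in [:: f; pd1 f; pd2 f] -> inside p ->
  is_derive p.2 1 (fun y => g (psi (p.1, y))) (pd2 g (psi p) * ttv p).
Proof.
move=> hg ip; have [_ /pd2_okP h] := C2_pd_ok hg (psi_UHD ip).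
have h' : is_derive (tt (p.1, p.2)) 1 (fun y => g (p.1, y)) (pd2 g (psi p)) := h.
exact: (@is_derive1_comp R (fun y => g (p.1, y)) (fun y => tt (p.1, y)) p.2 _ _ h' (is_derive_tt2 ip)).
Qed.

Lemma pd1_comp_psi p : inside p -> pd1 (f \o psi) p = pd1 f (psi p) + pd2 f (psi p) * ttu p.
Proof.
move=> ip; rewrite /pd1 derive1E.
have h := @is_derive_comp_psi1 f p (mem_head _ _) ip; exact: derive_val.
Qed.

Lemma pd2_comp_psi p : inside p -> pd2 (f \o psi) p = pd2 f (psi p) * ttv p.
Proof.
move=> ip; rewrite {1}/pd2 derive1E.
have h := @is_derive_comp_psi2 f p (mem_head _ _) ip; exact: derive_val.
Qed.

Let f1in : pd1 f \in [:: f; pd1 f; pd2 f]. Proof. by rewrite !inE eqxx orbT. Qed.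
Let f2in : pd2 f \in [:: f; pd1 f; pd2 f]. Proof. by rewrite !inE eqxx !orbT. Qed.

(** The first-order formulas hold only on [inside]; since that set is open they hold near the point
    on the slice and may be differentiated again. Both mixed derivatives of [f] appear here. *)
Lemma pd11_comp_psi p : inside p -> pd1 (pd1 (f \o psi)) p =
  pd1 (pd1 f) (psi p) + pd2 (pd1 f) (psi p) * ttu p +
  (pd2 f (psi p) * ((a - c) / ((b - a) * tt p) * (1 - p.1 * ttu p / tt p)) +
   ttu p * (pd1 (pd2 f) (psi p) + pd2 (pd2 f) (psi p) * ttu p)).
Proof.
move=> ip; rewrite {1}/pd1 derive1E.
have H := is_deriveD (is_derive_comp_psi1 f1in ip) (is_derive_mul (is_derive_comp_psi1 f2in ip) (is_derive_ttu1 ip)).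
rewrite /= -(surjective_pairing p) in H.
have /near_slice1 N := near_inside ip.
have E : \forall x \near p.1, pd1 f (psi (x, p.2)) + pd2 f (psi (x, p.2)) * ttu (x, p.2) = pd1 (f \o psi) (x, p.2).
  by apply: filterS N => x /pd1_comp_psi ->.
have H2 := near_eq_is_derive E H; exact: derive_val.
Qed.

Lemma pd12_comp_psi p : inside p -> pd1 (pd2 (f \o psi)) p =
  pd2 f (psi p) * (- (p.2 * ttu p) / ((b - a) * tt p ^+ 2)) +
   ttv p * (pd1 (pd2 f) (psi p) + pd2 (pd2 f) (psi p) * ttu p).
Proof.
move=> ip; rewrite {1}/pd1 derive1E.
have H := is_derive_mul (is_derive_comp_psi1 f2in ip) (is_derive_ttv1 ip).
rewrite /= -(surjective_pairing p) in H.
have /near_slice1 N := near_inside ip.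
have E : \forall x \near p.1, pd2 f (psi (x, p.2)) * ttv (x, p.2) = pd2 (f \o psi) (x, p.2).
  by apply: filterS N => x /pd2_comp_psi ->.
have H2 := near_eq_is_derive E H; exact: derive_val.
Qed.

Lemma pd22_comp_psi p : inside p -> pd2 (pd2 (f \o psi)) p =
  pd2 f (psi p) * ((1 - p.2 * ttv p / tt p) / ((b - a) * tt p)) +
   ttv p * (pd2 (pd2 f) (psi p) * ttv p).
Proof.
move=> ip; rewrite {1}/pd2 derive1E.
have H := is_derive_mul (is_derive_comp_psi2 f2in ip) (is_derive_ttv2 ip).
rewrite /= -(surjective_pairing p) in H.
have /near_slice2 N := near_inside ip.
have E : \forall y \near p.2, pd2 f (psi (p.1, y)) * ttv (p.1, y) = pd2 (f \o psi) (p.1, y).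
  by apply: filterS N => y /pd2_comp_psi ->.
have H2 := near_eq_is_derive E H; exact: derive_val.
Qed.

Lemma schwarz_psi p : inside p -> pd2 (pd1 f) (psi p) = pd1 (pd2 f) (psi p).
Proof.
move=> ip; have hU := psi_UHD ip; apply: schwarz.
- move: hU => /nbhs_interior; apply: filterS => q hq.
  have [h1 h2] := C2_pd_ok (mem_head _ _) hq.
  by have [_ h3] := C2_pd_ok f1in hq; have [h4 _] := C2_pd_ok f2in hq.
- have [_ _ _ c21 _] := C2_cont hU; exact: c21.
- have [_ _ c12 _ _] := C2_cont hU; exact: c12.
Qed.

(** Once the mixed derivatives are identified, the derivatives of [f] at [psi p] act as independent
    variables, and their coefficients agree by virtue of the single relation (b - a) t^2 = -a + (a -
    c) u^2 + v^2. *)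
Lemma frakD_comp_psi p : inside p -> frakD a b c k2 k3 (f \o psi) p = calD k2 k3 f (psi p).
Proof.
move=> ip; rewrite /frakD /calD (pd11_comp_psi ip) (pd12_comp_psi ip) (pd22_comp_psi ip).
rewrite (pd1_comp_psi ip) (pd2_comp_psi ip) (schwarz_psi ip) /ttu /ttv.
have t0 := tt_gt0 ip; have [v0 tau0 _] := ip.
have tt2 : tt p ^+ 2 = tau p by rewrite ttE sqr_sqrtr// ltW.
rewrite /psi /=; move: (pd1 f _) (pd2 f _) (pd1 (pd1 f) _) (pd1 (pd2 f) _) (pd2 (pd2 f) _) => F1 F2 F11 F12 F22.
move: t0 tt2 tau0 v0; rewrite /tau; move: (tt p) => t; case: p {ip} => u v /= t0 tt2 tau0 v0.
have ba : b - a != 0 by rewrite subr_eq0 gt_eqF.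
set N := - a + (a - c) * u ^+ 2 + v ^+ 2 in tt2 tau0.
have N0 : N != 0 by apply: contraTneq tau0 => ->; rewrite mul0r ltxx.
(* Eliminating b makes the identity rational in the remaining variables. *)
have bE : b = a + N / t ^+ 2 by rewrite tt2; field; rewrite N0 ba.
rewrite bE /N; rewrite /N in N0; field.
apply/and3P; split; [exact: lt0r_neq0| |exact: lt0r_neq0].
by rewrite [X in X != 0](_ : _ = - a + (a - c) * u ^+ 2 + v ^+ 2)//; ring.
Qed.

End derivatives.
End pullback.
Theorem theorem3p4 (R : realType) (a b c k2 k3 : R) :
  0 <= a -> a < b -> 0 <= c -> - 2^-1 < k2 -> -1 < k3 ->
  (forall (n : nat) (Y : R * R -> R),
     VnE (weight a b c k2 k3) (Omega a b c) n Y ->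
     forall p : R * R, Omega a b c p -> p.2 != 0 ->
       frakD a b c k2 k3 Y p
         = - (n%:R * (n%:R + 2 * k2 + 2 * k3 + 2)) * Y p) /\
  (forall f : R * R -> R,
     C2_on (interior (@upper_half_disk R)) f ->
     forall p : R * R, interior (Lambda a b c) p ->
       frakD a b c k2 k3 (f \o psi a b c) p = calD k2 k3 f (psi a b c p)).
Proof.
move=> a0 ab c0 k2g k3g; split.
  move=> n Y hY p pO p0; exact: frakD_eigen hY _ pO p0.
by move=> f hf p pL; apply: frakD_comp_psi => //; exact: interior_Lambda_inside pL.
Qed.
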